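(* Let $q$ be a complex number with $0<|q|<1$ and let $a,b,c,d$ be complex numbers. (i) If $q=abcd$ and $\max\{|q/a|,|q/a^2|\}<1$, then $${}_7\psi_7\!\left[\begin{matrix}a^{1/2},-a^{1/2},(qa)^{1/2},-(qa)^{1/2},b,c,d\\ qa^{-1/2},-qa^{-1/2},(q/a)^{1/2},-(q/a)^{1/2},q/b,q/c,q/d\end{matrix};q,\frac qa\right]=\frac{\left(q,\frac q{a^2};q\right)_\infty}{\left(\frac qa,\frac qa;q\right)_\infty}\;{}_4\phi_3\!\left[\begin{matrix}a,ab,ac,ad\\ q/b,q/c,q/d\end{matrix};q,\frac q{a^2}\right].$$ (ii) If $q^3=abcd$ and $\max\{|q^2/a|,|q^3/a^2|\}<1$, then $${}_7\psi_7\!\left[\begin{matrix}a^{1/2},-a^{1/2},(qa)^{1/2},-(qa)^{1/2},b,c,d\\ q^2a^{-1/2},-q^2a^{-1/2},(q^3/a)^{1/2},-(q^3/a)^{1/2},q^2/b,q^2/c,q^2/d\end{matrix};q,\frac{q^2}a\right]=\frac{\left(q,\frac{q^3}{a^2};q\right)_\infty}{\left(\frac{q^2}a,\frac{q^3}a;q\right)_\infty}\;{}_4\phi_3\!\left[\begin{matrix}a,ab/q,ac/q,ad/q\\ q^2/b,q^2/c,q^2/d\end{matrix};q,\frac{q^3}{a^2}\right].$$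
   Context: Notation. $(x;q)_\infty=\prod_{i=0}^\infty(1-xq^i)$ and, for every integer $n$, $(x;q)_n=(x;q)_\infty/(xq^n;q)_\infty$, i.e. $(x;q)_n=\prod_{i=0}^{n-1}(1-xq^i)$ for $n\ge0$ and $(x;q)_{-n}=\prod_{i=1}^{n}(1-xq^{-i})^{-1}$ for $n\geq 1$. For several parameters, $(x_1,\dots,x_s;q)_m=(x_1;q)_m\cdots(x_s;q)_m$ (a repeated parameter contributes a repeated factor). Bilateral series: ${}_s\psi_s\!\left[\begin{matrix}a_1,\dots,a_s\\ c_1,\dots,c_s\end{matrix};q,z\right]=\sum_{k=-\infty}^{\infty}\frac{(a_1,\dots,a_s;q)_k}{(c_1,\dots,c_s;q)_k}z^k.$ Unilateral series: ${}_4\phi_3\!\left[\begin{matrix}a_1,a_2,a_3,a_4\\ c_1,c_2,c_3\end{matrix};q,z\right]=\sum_{k=0}^\infty\frac{(a_1,a_2,a_3,a_4;q)_k}{(q,c_1,c_2,c_3;q)_k}z^k.$ $w^{1/2}$ denotes a square root of $w$; since every square root occurs together with its negative, the choices are immaterial. $a^{-1/2}=1/a^{1/2}$. Standing convention: the parameters are such that every expression occurring is well defined (no denominator vanishes, including the denominator factors of the terms of the series). *)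

(* Defs.v *)
From Stdlib Require Export Reals ZArith List.
From Coquelicot Require Export Coquelicot.
Export ListNotations.
Open Scope R_scope.

Fixpoint Cprod (f : nat -> C) (n : nat) : C :=
  match n with
  | O => 1%C
  | S m => (Cprod f m * f m)%C
  end.

Definition Cpowz (z : C) (k : Z) : C :=
  match k with
  | Z0 => 1%C
  | Zpos p => (z ^ Pos.to_nat p)%C
  | Zneg p => (/ z ^ Pos.to_nat p)%C
  end.

Definition qpoch (x q : C) (k : Z) : C :=
  match k with
  | Z0 => 1%C
  | Zpos p => Cprod (fun i => 1 - x * q ^ i)%C (Pos.to_nat p)
  | Zneg p => (/ Cprod (fun i => 1 - x / q ^ S i) (Pos.to_nat p))%C
  end.

(* [lim] is Coquelicot's limit in a complete space; the partial products
   always converge when |q| < 1. *)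
Definition qpoch_inf (x q : C) : C :=
  @lim C_CompleteNormedModule
    (filtermap (Cprod (fun i => 1 - x * q ^ i)%C) eventually).

Definition Cprod_list (l : list C) : C := fold_right Cmult 1%C l.

Definition qpochs (xs : list C) (q : C) (k : Z) : C :=
  Cprod_list (map (fun x => qpoch x q k) xs).

Definition qpochs_inf (xs : list C) (q : C) : C :=
  Cprod_list (map (fun x => qpoch_inf x q) xs).

(* Since [/ 0 = 0] in [C], the factor [/ qpoch c q (- n)] equals
   (1 - c/q) ... (1 - c/q^n) even when this product vanishes, i.e. when c is
   a positive power of q and the bilateral series terminates below. *)
Definition psi_term (xs cs : list C) (q z : C) (k : Z) : C :=
  (qpochs xs q k / qpochs cs q k * Cpowz z k)%C.

Definition phi_term (xs cs : list C) (q z : C) (n : nat) : C :=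
  (qpochs xs q (Z.of_nat n) / qpochs (q :: cs) q (Z.of_nat n) * z ^ n)%C.

(* Both halves of the two-sided series are required to converge. *)
Definition is_bilateral_series (f : Z -> C) (l : C) : Prop :=
  exists l1 l2 : C,
    is_series (fun n : nat => f (Z.of_nat n)) l1 /\
    is_series (fun n : nat => f (- Z.of_nat (S n))%Z) l2 /\
    l = (l1 + l2)%C.

Definition is_psi (xs cs : list C) (q z l : C) : Prop :=
  is_bilateral_series (psi_term xs cs q z) l.

Definition is_phi (xs cs : list C) (q z l : C) : Prop :=
  is_series (phi_term xs cs q z) l.

(* No term of the bilateral series has a vanishing denominator: the factors
   of (c;q)_k, k >= 0, and those of 1/(x;q)_{-k}, k >= 1, are nonzero. *)
Definition psi_defined (xs cs : list C) (q : C) : Prop :=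
  (forall c, In c cs -> forall i : nat, (1 - c * q ^ i)%C <> 0%C) /\
  (forall x, In x xs -> forall i : nat, (1 - x / q ^ S i)%C <> 0%C).

(* Main.v *)
Require Import Defs.
From Stdlib Require Import Lia Lra.

(** Let [p = 1] in (i) and [p = q] in (ii), so that [a b c d = p^2 q], and put
    [z = p^2 q / a^2].  The q-Gauss sum gives
    [sum_(n >= k) (a/p)_(n-k) (a)_(n+k) / ((q)_(n-k) (pq)_(n+k)) z^n
       = z^k (a)_(2k) / (p^2 q/a)_(2k) * const],
    whose right-hand side is the [a]-dependent part of the bilateral term.
    Inserting it into the bilateral series, folded to a series over [k >= 0],
    and exchanging the sums (Tannery's theorem) leaves a finite inner sum over
    [k <= n].  That one is Jackson's terminating very-well-poised sum, proved by
    telescoping, and it equals the [n]-th coefficient of the 4-phi-3 series.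
    The folding rests on the reflections [f(-k) = q^k f(k)] in case (i) and
    [f(-1-k) = - q^(2k+1) f(k)] in case (ii). *)

Open Scope C_scope.

(** * Limits and series of complex numbers *)

(** With the q-Gauss parameters a/p, a q^(2k) and p q^(2k+1) the argument is p^2 q/a^2, free of k;
    this is why one power series in z can collect the contributions of all k. The finite inner sum
    is then a terminating 8-phi-7 with base parameter p and further parameters b, c, d, a q^n,
    q^(-n), and its balancing condition is exactly a b c d = p^2 q. Jackson's sum also needs the
    very-well-poised factor (1 - p q^(2k)) (p)_k / ((1 - p) (q)_k), which the bilateral term lacks.
    Folding supplies it: as 1 + q^k for k >= 1 when p = 1, and as (1 - q^(2k+1)) / (1 - q) when p =
    q. The two size hypotheses have separate tasks: |z| < 1 bounds the inner Gauss sums uniformly in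
    k, and |p q/a| < 1 makes the outer sum dominated. The square roots disappear early, since a root
    and its negative always occur together. *)

Definition cv (u : nat -> C) (l : C) : Prop :=
  filterlim u eventually (@locally C_UniformSpace l).
Notation "u ~> l" := (cv u l) (at level 70).

Lemma Cinv_0 : / 0 = (0 : C).
Proof. unfold Cinv; apply injective_projections; cbn; unfold Rdiv; ring. Qed.

(** The convention [/ 0 = 0] removes the nonvanishing hypotheses, so quotients of long products can
    be regrouped by [ring] alone. *)
Lemma Cinv_mult (x y : C) : / (x * y) = / x * / y.
Proof.
destruct (Ceq_dec x 0) as [->|hx]; [now rewrite Cmult_0_l, Cinv_0, Cmult_0_l|].
destruct (Ceq_dec y 0) as [->|hy]; [now rewrite Cmult_0_r, Cinv_0, Cmult_0_r|].
field; now split.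
Qed.

Lemma Cinv_inv (x : C) : / / x = x.
Proof.
destruct (Ceq_dec x 0) as [->|hx]; [now rewrite !Cinv_0|].
field; exact hx.
Qed.

Lemma Cmod_minus_sym (x y : C) : Cmod (x - y) = Cmod (y - x).
Proof. rewrite <- Cmod_opp; f_equal; ring. Qed.

Lemma cv_iff (u : nat -> C) (l : C) :
  u ~> l <->
  (forall eps : R, 0 < eps ->
    exists N, forall n, (N <= n)%nat -> Cmod (u n - l) < eps)%R.
Proof.
unfold cv; rewrite (@filterlim_locally_ball_norm C_AbsRing nat C_NormedModule eventually _).
split; intros h.
- intros eps he; destruct (h (mkposreal eps he)) as [N hN]; exists N; exact hN.
- intros [eps he]; destruct (h eps he) as [N hN]; exists N; exact hN.
Qed.

Lemma cv_const (l : C) : (fun _ => l) ~> l.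
Proof. apply filterlim_const. Qed.

Lemma cv_ext (u v : nat -> C) (l : C) :
  (forall n, u n = v n) -> u ~> l -> v ~> l.
Proof. intros h; exact (filterlim_ext u v h). Qed.

Lemma cv_plus (u v : nat -> C) (l m : C) :
  u ~> l -> v ~> m -> (fun n => u n + v n) ~> (l + m).
Proof.
intros hu hv; refine (filterlim_comp_2 u v Cplus hu hv _).
exact (@filterlim_plus C_AbsRing C_NormedModule l m).
Qed.

Lemma cv_mult (u v : nat -> C) (l m : C) :
  u ~> l -> v ~> m -> (fun n => u n * v n) ~> (l * m).
Proof.
rewrite !cv_iff; intros hu hv eps he.
set (M := (Cmod l + Cmod m + 1)%R).
assert (hM : (0 < M)%R)
  by (unfold M; pose proof (Cmod_ge_0 l); pose proof (Cmod_ge_0 m); lra).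
set (e := Rmin 1 (eps / (2 * M))).
assert (he' : (0 < e)%R).
{ unfold e; apply Rmin_pos; [lra|].
  apply Rdiv_lt_0_compat; lra. }
destruct (hu e he') as [N1 h1]; destruct (hv e he') as [N2 h2].
exists (max N1 N2); intros n hn.
specialize (h1 n ltac:(lia)); specialize (h2 n ltac:(lia)).
replace (u n * v n - l * m)
  with ((u n - l) * (v n - m) + (u n - l) * m + l * (v n - m)) by ring.
eapply Rle_lt_trans; [apply Cmod_triangle|].
eapply Rle_lt_trans; [apply Rplus_le_compat_r, Cmod_triangle|].
rewrite !Cmod_mult.
assert (e1 : (e <= 1)%R) by apply Rmin_l.
assert (e2 : (e * (2 * M) <= eps)%R).
{ unfold e; eapply Rle_trans.
  - apply Rmult_le_compat_r; [lra|apply Rmin_r].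
  - right; field; lra. }
pose proof (Cmod_ge_0 (u n - l)); pose proof (Cmod_ge_0 (v n - m)).
pose proof (Cmod_ge_0 l); pose proof (Cmod_ge_0 m).
unfold M in *.
nra.
Qed.

Lemma cv_unique (u : nat -> C) (l m : C) : u ~> l -> u ~> m -> l = m.
Proof. exact (@filterlim_locally_unique nat C_AbsRing C_NormedModule _ _ u l m). Qed.

Lemma cv_squeeze (u : nat -> C) (l : C) (r : nat -> R) :
  (forall n, Cmod (u n - l) <= r n)%R -> is_lim_seq r 0 -> u ~> l.
Proof.
intros h hr; apply cv_iff; intros eps he.
apply is_lim_seq_spec in hr; destruct (hr (mkposreal eps he)) as [N hN].
exists N; intros n hn; specialize (hN n hn); cbn in hN.
eapply Rle_lt_trans; [apply h|]; rewrite Rminus_0_r in hN.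
eapply Rle_lt_trans; [apply Rle_abs|exact hN].
Qed.

Lemma cv_geom (q : C) : (Cmod q < 1)%R -> (fun n => q ^ n) ~> 0.
Proof.
intros hq; apply (cv_squeeze _ _ (fun n => Cmod q ^ n)%R).
- intros n; replace (q ^ n - 0) with (q ^ n) by ring.
  rewrite Cmod_pow; apply Rle_refl.
- apply is_lim_seq_geom; rewrite Rabs_pos_eq; [exact hq|apply Cmod_ge_0].
Qed.

Lemma cv_shift (u : nat -> C) (l : C) (m : nat) :
  u ~> l -> (fun n => u (m + n)%nat) ~> l.
Proof.
rewrite !cv_iff; intros h eps he; destruct (h eps he) as [N hN].
exists N; intros n hn; apply hN; lia.
Qed.

Lemma cv_Cmod_le (u : nat -> C) (l : C) (M : R) :
  u ~> l -> (forall n, Cmod (u n) <= M)%R -> (Cmod l <= M)%R.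
Proof.
intros hu hM; apply Rnot_lt_le; intros hlt.
apply cv_iff with (eps := (Cmod l - M)%R) in hu; [|lra].
destruct hu as [N hN]; specialize (hN N (le_n N)); specialize (hM N).
pose proof (Cmod_triangle (u N) (l - u N)) as ht.
replace (u N + (l - u N)) with l in ht by ring.
rewrite (Cmod_minus_sym l) in ht; lra.
Qed.

(** * Finite sums, dominated series and Tannery's theorem *)

Definition Csum (f : nat -> C) (n : nat) : C := sum_n f n.

Lemma Csum_S (f : nat -> C) (n : nat) :
  Csum f (S n) = Csum f n + f (S n).
Proof. exact (sum_Sn f n). Qed.

Lemma sum_n_SR (f : nat -> R) (n : nat) :
  sum_n f (S n) = (sum_n f n + f (S n))%R.
Proof. exact (sum_Sn f n). Qed.

Lemma Csum_0 (f : nat -> C) : Csum f 0 = f 0%nat.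
Proof. exact (sum_O f). Qed.

Lemma Csum_scal (c : C) (f : nat -> C) (n : nat) :
  Csum (fun k => c * f k) n = c * Csum f n.
Proof.
induction n as [|n IH]; [now rewrite !Csum_0|].
rewrite !Csum_S, IH; ring.
Qed.

Lemma Csum_plus (f g : nat -> C) (n : nat) :
  Csum (fun k => f k + g k) n = Csum f n + Csum g n.
Proof.
induction n as [|n IH]; [now rewrite !Csum_0|].
rewrite !Csum_S, IH; ring.
Qed.

Lemma Csum_minus (f g : nat -> C) (n : nat) :
  Csum (fun k => f k - g k) n = Csum f n - Csum g n.
Proof.
induction n as [|n IH]; [now rewrite !Csum_0|].
rewrite !Csum_S, IH; ring.
Qed.

Lemma Csum_ext (f g : nat -> C) (n : nat) :
  (forall k, (k <= n)%nat -> f k = g k) -> Csum f n = Csum g n.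
Proof. exact (sum_n_ext_loc f g n). Qed.

Lemma Cmod_sum_le (f : nat -> C) (g : nat -> R) (n : nat) :
  (forall k, (k <= n)%nat -> Cmod (f k) <= g k)%R ->
  (Cmod (Csum f n) <= sum_n g n)%R.
Proof.
induction n as [|n IH]; intros h.
- rewrite Csum_0, sum_O; apply h; lia.
- rewrite Csum_S, sum_Sn.
  eapply Rle_trans; [apply Cmod_triangle|].
  apply Rplus_le_compat; [apply IH; intros; apply h; lia|apply h; lia].
Qed.

Lemma sum_triangle_swap (f : nat -> nat -> C) (N : nat) :
  Csum (fun n => Csum (fun k => f k (n - k)%nat) n) N
  = Csum (fun k => Csum (fun j => f k j) (N - k)) N.
Proof.
induction N as [|N IH]; [now rewrite !Csum_0|].
rewrite Csum_S, IH, Csum_S, (Csum_S _ N), Nat.sub_diag, Csum_0.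
rewrite Cplus_assoc; f_equal.
rewrite <- Csum_plus; apply Csum_ext; intros k hk.
replace (S N - k)%nat with (S (N - k)) by lia.
now rewrite Csum_S.
Qed.

Lemma is_series_cv (f : nat -> C) (l : C) :
  is_series f l <-> Csum f ~> l.
Proof. reflexivity. Qed.

Lemma ex_series_geom_scal (M r : R) :
  (0 <= r < 1)%R -> ex_series (fun n => M * r ^ n)%R.
Proof.
intros hr; apply (@ex_series_scal_l R_AbsRing R_NormedModule).
exists (/ (1 - r))%R; apply is_series_geom; rewrite Rabs_pos_eq; lra.
Qed.

Lemma ex_series_dominated (f : nat -> C) (g : nat -> R) :
  (forall n, Cmod (f n) <= g n)%R -> ex_series g ->
  exists l : C, is_series f l.
Proof.
intros h hg; exact (@ex_series_le C_AbsRing C_CompleteNormedModule f g h hg).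
Qed.

Lemma Csum_geom_le (f : nat -> C) (M r : R) (n : nat) :
  (0 <= r < 1)%R -> (forall n, Cmod (f n) <= M * r ^ n)%R ->
  (Cmod (Csum f n) <= M / (1 - r))%R.
Proof.
intros hr hb.
assert (hM : (0 <= M)%R)
  by (specialize (hb 0%nat); pose proof (Cmod_ge_0 (f 0%nat)); cbn in hb; lra).
eapply Rle_trans; [apply Cmod_sum_le; intros; apply hb|].
assert (e : sum_n (fun k => M * r ^ k)%R n = (M * (1 - r ^ S n) / (1 - r))%R).
{ clear hb; induction n as [|n IH]; [rewrite sum_O; cbn; field; lra|].
  rewrite sum_n_SR, IH; cbn; field; lra. }
rewrite e; unfold Rdiv; apply Rmult_le_compat_r.
- apply Rlt_le, Rinv_0_lt_compat; lra.
- assert (0 <= r ^ S n)%R by (apply pow_le; lra); nra.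
Qed.

Lemma is_series_Cmod_le (f : nat -> C) (l : C) (M r : R) :
  (0 <= r < 1)%R -> is_series f l ->
  (forall n, Cmod (f n) <= M * r ^ n)%R -> (Cmod l <= M / (1 - r))%R.
Proof.
intros hr hf hb; apply (cv_Cmod_le (Csum f)); [exact hf|].
intros n; apply Csum_geom_le; assumption.
Qed.

(** Cut at a fixed K where the tail of [B] is small: the head is a fixed finite sum and tends to 0
    term by term, and the rest is at most twice the tail of [B], uniformly in N. *)
Lemma tannery (F : nat -> nat -> C) (L : nat -> C) (B : nat -> R) :
  ex_series B -> (forall N k, Cmod (F N k) <= B k)%R ->
  (forall k, (fun N => F N k) ~> L k) ->
  exists l : C, is_series L l /\ (fun N => Csum (F N) N) ~> l.
Proof.
intros hB hF hL.
assert (hLB : forall k, (Cmod (L k) <= B k)%R)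
  by (intros k; apply (cv_Cmod_le (fun N => F N k)); auto).
destruct (ex_series_dominated L B hLB hB) as [l hl]; exists l; split; [exact hl|].
assert (hd : (fun N => Csum (fun k => F N k - L k) N) ~> 0).
{ apply cv_iff; intros eps he.
  destruct hB as [b hb].
  assert (hb' := proj2 (is_lim_seq_spec (sum_n B) b) hb).
  (* Two partial sums of [B] within eps/8 of the limit differ by less than eps/4. Doubled, this
     leaves eps/2 for the tail, next to eps/4 for the head. *)
  destruct (hb' (mkposreal (eps / 8) ltac:(lra))) as [K hK]; cbn [pos] in hK.
  assert (hfin : (fun N => Csum (fun k => F N k - L k) K) ~> 0).
  { clear hK; induction K as [|K IH].
    - apply (cv_ext (fun N => F N 0%nat + - L 0%nat)).
      + intros n; now rewrite Csum_0.
      + replace (0 : C) with (L 0%nat + - L 0%nat) by ring.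
        apply cv_plus; [apply hL|apply cv_const].
    - apply (cv_ext (fun N => Csum (fun k => F N k - L k) K
                              + (F N (S K) + - L (S K)))).
      + intros n; now rewrite Csum_S.
      + replace (0 : C) with (0 + (L (S K) + - L (S K))) by ring.
        apply cv_plus; [exact IH|].
        apply cv_plus; [apply hL|apply cv_const]. }
  apply cv_iff with (eps := (eps / 4)%R) in hfin; [|lra].
  destruct hfin as [N0 hN0]; exists (max N0 K); intros N hN.
  specialize (hN0 N ltac:(lia)).
  assert (htail : forall m, (Cmod (Csum (fun k => F N k - L k)%C (K + m)
      - Csum (fun k => F N k - L k)%C K)
      <= 2 * (sum_n B (K + m) - sum_n B K))%R).
  { induction m as [|m IH].
    - rewrite Nat.add_0_r; unfold Cminus; rewrite Cplus_opp_r, Cmod_0; lra.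
    - rewrite Nat.add_succ_r, Csum_S, sum_n_SR.
      match goal with |- (Cmod (?s + ?t - ?u) <= _)%R =>
        replace (s + t - u) with ((s - u) + t) by ring end.
      eapply Rle_trans; [apply Cmod_triangle|].
      pose proof (Cmod_triangle (F N (S (K + m))) (- L (S (K + m)))) as ht.
      rewrite Cmod_opp in ht.
      pose proof (hF N (S (K + m))); pose proof (hLB (S (K + m))).
      unfold Cminus in *; lra. }
  specialize (htail (N - K)%nat).
  replace (K + (N - K))%nat with N in htail by lia.
  pose proof (hK K (le_n K)) as h1; pose proof (hK N ltac:(lia)) as h2.
  apply Rabs_def2 in h1; apply Rabs_def2 in h2.
  set (s := Csum (fun k => F N k - L k) N) in *.
  set (t := Csum (fun k => F N k - L k) K) in *.
  replace (s - 0) with ((s - t) + (t - 0)) by ring.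
  eapply Rle_lt_trans; [apply Cmod_triangle|]; lra. }
apply (cv_ext (fun N => Csum (fun k => F N k - L k) N + Csum L N)).
- intros N; rewrite Csum_minus; ring.
- replace l with (0 + l) by ring; apply cv_plus; [exact hd|exact hl].
Qed.

(** * Jackson's sum *)

Definition qp (x q : C) (n : nat) : C := Cprod (fun i => 1 - x * q ^ i) n.

Lemma qp_S (x q : C) (n : nat) : qp x q (S n) = qp x q n * (1 - x * q ^ n).
Proof. reflexivity. Qed.

Lemma qp_0 (x q : C) : qp x q 0 = 1.
Proof. reflexivity. Qed.

Lemma qp_add (x q : C) (m n : nat) :
  qp x q (m + n) = qp x q m * qp (x * q ^ m) q n.
Proof.
induction n as [|n IH]; [rewrite Nat.add_0_r, qp_0; ring|].
rewrite Nat.add_succ_r, !qp_S, IH, Cpow_add_r; ring.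
Qed.

Lemma qp_nz (x q : C) (n : nat) :
  (forall i, 1 - x * q ^ i <> 0) -> qp x q n <> 0.
Proof.
intros h; induction n as [|n IH]; [exact C1_nz|].
rewrite qp_S; apply Cmult_neq_0; auto.
Qed.

Definition pole_free (x q : C) : Prop := forall i : nat, 1 - x * q ^ i <> 0.

Lemma pole_free_shift (x q : C) (m : nat) :
  pole_free x q -> pole_free (x * q ^ m) q.
Proof.
intros h i; specialize (h (m + i)%nat); rewrite Cpow_add_r in h.
now rewrite <- Cmult_assoc.
Qed.

Lemma one_minus_nz (x : C) : (Cmod x < 1)%R -> 1 - x <> 0.
Proof.
intros h e; assert (e' : x = 1) by (rewrite <- (Cplus_0_r x), <- e; ring).
rewrite e', Cmod_1 in h; lra.
Qed.

Lemma pole_free_small (x q : C) :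
  (Cmod q <= 1)%R -> (Cmod x < 1)%R -> pole_free x q.
Proof.
intros hq hx i; apply one_minus_nz.
rewrite Cmod_mult, Cmod_pow; pose proof (Cmod_ge_0 x); pose proof (Cmod_ge_0 q).
assert (Cmod q ^ i <= 1)%R by (rewrite <- (pow1 i); apply pow_incr; lra).
assert (0 <= Cmod q ^ i)%R by (apply pow_le; lra).
nra.
Qed.

Definition well_poised3 (p q b c d : C) (k : nat) : C :=
  qp b q k * qp c q k * qp d q k
  / (qp (p * q / b) q k * qp (p * q / c) q k * qp (p * q / d) q k).

(* [(1 - p q^2k) (p)_k / ((1 - p) (q)_k)], with the factor [1 - p] cancelled so
   that [p = 1] is allowed. *)
Definition very_well (p q : C) (k : nat) : C :=
  match k with
  | O => 1
  | S j => (1 - p * (q ^ S j * q ^ S j)) * qp (p * q) q j / qp q q (S j)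
  end.

Definition kernel (p q a : C) (k j : nat) : C :=
  qp (a / p) q j * qp a q (2 * k + j) / (qp q q j * qp (p * q) q (2 * k + j)).

(** Reversing the factors of index n - k turns (a/p)_(n-k) / (q)_(n-k) into (q^(-n))_k / (p
    q^(1-n)/a)_k times (p q/a)^k, up to a factor free of k. Together with (a/p)^k this leaves the
    argument q of Jackson's 8-phi-7. The unreversed form avoids negative powers of q. *)
Definition jackson_term (p q a b c d : C) (n k : nat) : C :=
  very_well p q k * well_poised3 p q b c d k * (a / p) ^ k * kernel p q a k (n - k).

Lemma Cminus_eq_0 (x y : C) : x - y = 0 -> x = y.
Proof. intros h; replace x with (x - y + y) by ring; rewrite h; ring. Qed.

(** [field] states its side conditions with inner denominators cleared; this brings the pole
    conditions into that shape. *)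
Lemma clear_den (u v x : C) : v <> 0 -> 1 - u / v * x <> 0 -> v - u * x <> 0.
Proof.
intros hv h e; apply h; replace (1 - u / v * x) with ((v - u * x) / v) by (field; auto).
rewrite e; field; auto.
Qed.

(* The right-hand side is the Wilf-Zeilberger certificate of Jackson's sum. *)
Lemma jackson_telescope (p q a b c d : C) (k j : nat) :
  q <> 0 -> p <> 0 -> a <> 0 -> b <> 0 -> c <> 0 -> a * b * c * d = p ^ 2 * q ->
  pole_free q q -> pole_free (p * q) q ->
  pole_free (p * q / b) q -> pole_free (p * q / c) q -> pole_free (p * q / d) q ->
  let y := q ^ (k + j) in
  Csum (fun i =>
    (1 - q * y) * (1 - p * q / b * y) * (1 - p * q / c * y) * (1 - p * q / d * y)
      * jackson_term p q a b c d (S (k + j)) i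
    - (1 - a * y) * (1 - a * b / p * y) * (1 - a * c / p * y) * (1 - a * d / p * y)
      * jackson_term p q a b c d (k + j) i) k
  = - q ^ j * (1 - a * q * (y * y)) * (a / p) ^ S k * qp (p * q) q k / qp q q k
    * (qp b q (S k) * qp c q (S k) * qp d q (S k))
    / (qp (p * q / b) q k * qp (p * q / c) q k * qp (p * q / d) q k)
    * (qp (a / p) q j * qp a q (S (2 * k + j)))
    / (qp q q j * qp (p * q) q (S (2 * k + j))).
Proof.
intros hq hp ha hb hc habcd Hq Hpq Hb Hc Hd.
assert (hd : d = p ^ 2 * q / (a * b * c)).
{ rewrite <- habcd; field; auto. }
assert (e : p * q / d = a * b * c / p).
{ rewrite hd; field; auto. }
rewrite e in *; revert j; induction k as [|k IH]; intros j y.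
- rewrite Csum_0; subst y; unfold jackson_term, kernel, well_poised3.
  rewrite e, Nat.sub_0_r, !Nat.sub_0_r; cbn [very_well Nat.add Nat.mul].
  rewrite !qp_S, !qp_0.
  assert (h1 := qp_nz _ _ j Hq); assert (h2 := qp_nz _ _ j Hpq).
  specialize (Hq j); specialize (Hpq j).
  (* Once the products and powers become independent variables and d is eliminated by the balancing
     condition, the goal is a rational-function identity for [field]. *)
  generalize dependent (qp q q j); generalize dependent (qp (p * q) q j).
  intros P2 h2 P1 h1; generalize dependent (q ^ j); intros t Hq Hpq.
  generalize (qp a q j) (qp (a / p) q j); intros A A'.
  rewrite hd; cbn [Cpow].
  field; repeat split; auto.
(* The n of Jackson's sum is k + j and stays fixed. Lengthening the partial sum lowers j by one, so
   the induction hypothesis is taken at [S j]; the slack j keeps every n - i from being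
   truncated. *)
- assert (ey : y = q ^ (k + S j)) by (subst y; f_equal; lia).
  rewrite Csum_S; replace (S k + j)%nat with (k + S j)%nat by lia.
  rewrite ey, IH; clear IH ey y.
  unfold jackson_term, kernel, well_poised3; rewrite e.
  replace (S (k + S j) - S k)%nat with (S j) by lia.
  replace (k + S j - S k)%nat with j by lia.
  replace (2 * k + S j)%nat with (S (2 * k + j)) by lia.
  replace (2 * S k + S j)%nat with (S (S (S (2 * k + j)))) by lia.
  replace (2 * S k + j)%nat with (S (S (2 * k + j))) by lia.
  cbn [very_well]; rewrite !qp_S.
  assert (h1 := qp_nz _ _ k Hq); assert (h2 := qp_nz _ _ j Hq).
  assert (h3 := qp_nz _ _ (2 * k + j) Hpq); assert (h4 := qp_nz _ _ k Hpq).
  assert (h5 := qp_nz _ _ k Hb); assert (h6 := qp_nz _ _ k Hc).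
  assert (h7 := qp_nz _ _ k Hd).
  assert (h8 := Hq k); assert (h9 := Hq j).
  assert (h10 := Hpq k); assert (h11 := Hpq (2 * k + j)%nat).
  assert (h12 := Hpq (S (2 * k + j))); assert (h13 := Hpq (S (S (2 * k + j)))).
  assert (h14 := Hb k); assert (h15 := Hc k); assert (h16 := Hd k).
  clear Hq Hpq Hb Hc Hd.
  replace (q ^ (k + S j)) with (q * q ^ k * q ^ j)
    by (rewrite Cpow_add_r; cbn [Cpow]; ring).
  assert (e2 : q ^ (2 * k + j) = q ^ k * q ^ k * q ^ j)
    by (rewrite <- !Cpow_add_r; f_equal; lia).
  cbn [Cpow] in *; rewrite e2 in *; clear e2.
  generalize dependent (qp q q k); generalize dependent (qp q q j).
  generalize dependent (qp (p * q) q k); generalize dependent (qp (p * q) q (2 * k + j)).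
  generalize dependent (qp (p * q / b) q k); generalize dependent (qp (p * q / c) q k).
  generalize dependent (qp (a * b * c / p) q k).
  generalize (qp b q k) (qp c q k) (qp d q k) (qp (a / p) q j) (qp a q (2 * k + j)).
  generalize dependent (q ^ k); generalize dependent (q ^ j); generalize ((a / p) ^ k).
  intros w t h9 x h8 h10 h11 h12 h13 h14 h15 h16 Pb Pc Pd Pa' Pa.
  intros Q1 n1 Q2 n2 Q3 n3 Q4 n4 Q5 n5 Q6 n6 Q7 n7.
  apply Cminus_eq_0.
  assert (m14 := clear_den _ _ _ hb h14); assert (m15 := clear_den _ _ _ hc h15).
  assert (m16 := clear_den _ _ _ hp h16).
  rewrite hd.
  field.
  repeat split; auto.
Qed.

Lemma jackson_sum (p q a b c d : C) (n : nat) :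
  q <> 0 -> p <> 0 -> a <> 0 -> b <> 0 -> c <> 0 -> a * b * c * d = p ^ 2 * q ->
  pole_free q q -> pole_free (p * q) q ->
  pole_free (p * q / b) q -> pole_free (p * q / c) q -> pole_free (p * q / d) q ->
  Csum (jackson_term p q a b c d n) n
  = qp a q n * qp (a * b / p) q n * qp (a * c / p) q n * qp (a * d / p) q n
    / (qp q q n * qp (p * q / b) q n * qp (p * q / c) q n * qp (p * q / d) q n).
Proof.
intros hq hp ha hb hc habcd Hq Hpq Hb Hc Hd; induction n as [|n IH].
{ rewrite Csum_0; unfold jackson_term, well_poised3, kernel, very_well.
  rewrite Nat.sub_0_r; cbn [Nat.mul Nat.add]; rewrite !qp_0; cbn [Cpow].
  field. }
assert (hd2 : d = p ^ 2 * q / (a * b * c)).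
{ rewrite <- habcd; field; auto. }
assert (hd : p * q / d = a * b * c / p) by (rewrite hd2; field; auto).
assert (hd' : a * d / p = p * q / (b * c)) by (rewrite hd2; field; auto).
(* At j = 0 the certificate covers i <= n and gives the recurrence from n to n + 1, except for the
   term i = n + 1 of the new sum. That term is split off, and the recurrence is solved for the
   remaining sum by dividing by its leading coefficient [D]. *)
pose proof (jackson_telescope p q a b c d n 0 hq hp ha hb hc habcd Hq Hpq Hb Hc Hd) as ht.
cbn zeta in ht; rewrite Csum_minus, !Csum_scal, !Nat.add_0_r, IH in ht.
rewrite Csum_S.
assert (e : jackson_term p q a b c d (S n) (S n) =
  (1 - p * (q ^ S n * q ^ S n)) * qp (p * q) q n / qp q q (S n)
  * well_poised3 p q b c d (S n) * (a / p) ^ S n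
  * (qp a q (S (S (2 * n))) / qp (p * q) q (S (S (2 * n))))).
{ unfold jackson_term, kernel; rewrite Nat.sub_diag, Nat.add_0_r, !(qp_0 _ q).
  replace (2 * S n)%nat with (S (S (2 * n))) by lia; cbn [very_well].
  rewrite !Cmult_1_l; reflexivity. }
rewrite e; clear e; unfold well_poised3.
assert (e2 : q ^ (2 * n) = q ^ n * q ^ n)
  by (rewrite <- !Cpow_add_r; f_equal; lia).
assert (h1 := qp_nz _ _ n Hq); assert (h3 := qp_nz _ _ (2 * n) Hpq).
assert (h4 := qp_nz _ _ n Hpq); assert (h5 := qp_nz _ _ n Hb).
assert (h6 := qp_nz _ _ n Hc); assert (h7 := qp_nz _ _ n Hd).
assert (h8 := Hq n); assert (h10 := Hpq n); assert (h11 := Hpq (2 * n)%nat).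
assert (h12 := Hpq (S (2 * n))).
assert (h14 := Hb n); assert (h15 := Hc n); assert (h16 := Hd n).
clear Hq Hpq Hb Hc Hd IH.
rewrite !qp_S in *; rewrite !qp_0 in ht; cbn [Cpow] in *; rewrite e2 in *; clear e2.
rewrite hd, hd' in *.
revert ht.
generalize (Csum (jackson_term p q a b c d (S n)) n); intros S ht.
set (D := (1 - q * q ^ n) * (1 - p * q / b * q ^ n) * (1 - p * q / c * q ^ n)
  * (1 - a * b * c / p * q ^ n)) in ht.
assert (hD : D <> 0) by (unfold D; repeat apply Cmult_neq_0; auto).
assert (hS : forall u v, D * S - u = v -> S = (u + v) / D)
  by (intros u v <-; field; exact hD).
apply hS in ht; rewrite ht; clear ht hS; revert hD; unfold D; clear D; intros hD.
assert (m14 := clear_den _ _ _ hb h14); assert (m15 := clear_den _ _ _ hc h15).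
assert (m16 := clear_den _ _ _ hp h16).
clear hD.
generalize dependent (qp q q n); generalize dependent (qp (p * q) q n).
generalize dependent (qp (p * q) q (2 * n)).
generalize dependent (qp (p * q / b) q n); generalize dependent (qp (p * q / c) q n).
generalize dependent (qp (a * b * c / p) q n).
generalize (qp b q n) (qp c q n) (qp d q n) (qp a q n) (qp a q (2 * n)).
generalize (qp (a * b / p) q n) (qp (a * c / p) q n) (qp (p * q / (b * c)) q n).
generalize dependent (q ^ n); generalize ((a / p) ^ n).
rewrite hd2; clear habcd.
intros; apply Cminus_eq_0; field.
repeat split; auto.
Qed.

(** * Infinite products and the q-Gauss sum *)

Lemma qp_upper (x q : C) :
  (Cmod q < 1)%R -> exists M, (0 < M)%R /\ forall n, (Cmod (qp x q n) <= M)%R.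
Proof.
intros hq; pose proof (Cmod_ge_0 x) as hx; pose proof (Cmod_ge_0 q) as hq0.
(* Each factor is bounded by 1 + u <= exp u. The exponent is the exact partial geometric sum, so
   that the induction closes. *)
assert (h : forall n, (Cmod (qp x q n)
    <= exp (Cmod x * (1 - Cmod q ^ n) / (1 - Cmod q)))%R).
{ induction n as [|n IH].
  - rewrite qp_0, Cmod_1; cbn; rewrite Rminus_diag; unfold Rdiv.
    rewrite Rmult_0_r, Rmult_0_l, exp_0; lra.
  - rewrite qp_S, Cmod_mult.
    replace (Cmod x * (1 - Cmod q ^ S n) / (1 - Cmod q))%R
      with (Cmod x * (1 - Cmod q ^ n) / (1 - Cmod q) + Cmod x * Cmod q ^ n)%R
      by (cbn; field; lra).
    rewrite exp_plus; apply Rmult_le_compat; try apply Cmod_ge_0; [exact IH|].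
    eapply Rle_trans; [|apply exp_ineq1_le].
    eapply Rle_trans; [apply Cmod_triangle|].
    rewrite Cmod_1, Cmod_opp, Cmod_mult, Cmod_pow; apply Rle_refl. }
exists (exp (Cmod x / (1 - Cmod q))); split; [apply exp_pos|]; intros n.
eapply Rle_trans; [apply h|].
assert (hle : (Cmod x * (1 - Cmod q ^ n) / (1 - Cmod q) <= Cmod x / (1 - Cmod q))%R).
{ unfold Rdiv; apply Rmult_le_compat_r; [apply Rlt_le, Rinv_0_lt_compat; lra|].
  assert (0 <= Cmod q ^ n)%R by (apply pow_le; lra); nra. }
destruct hle as [hlt|heq]; [apply Rlt_le, exp_increasing, hlt|rewrite heq; apply Rle_refl].
Qed.

(* A tail of the product is at least [1/2] by Weierstrass's inequality
   [prod (1 - u_i) >= 1 - sum u_i]; finitely many factors remain. *)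
Lemma qp_lower (x q : C) :
  (Cmod q < 1)%R -> pole_free x q ->
  exists m, (0 < m)%R /\ forall n, (m <= Cmod (qp x q n))%R.
Proof.
intros hq; pose proof (Cmod_ge_0 q) as hq0.
(* Below this threshold the sum of all |x| |q|^i is at most 1/2. *)
assert (hsmall : forall x, (Cmod x <= (1 - Cmod q) / 2)%R ->
  exists m, (0 < m)%R /\ forall n, (m <= Cmod (qp x q n))%R).
{ clear x; intros x hx; pose proof (Cmod_ge_0 x) as hx0.
  exists (1 / 2)%R; split; [lra|]; intros n.
  assert (h : (1 - Cmod x * (1 - Cmod q ^ n) / (1 - Cmod q) <= Cmod (qp x q n))%R).
  { induction n as [|n IH].
    - rewrite qp_0, Cmod_1; cbn; rewrite Rminus_diag; unfold Rdiv.
      rewrite Rmult_0_r, Rmult_0_l; lra.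
    - rewrite qp_S, Cmod_mult.
      assert (hu : (1 - Cmod x * Cmod q ^ n <= Cmod (1 - x * q ^ n))%R).
      { pose proof (Cmod_triangle (1 - x * q ^ n) (x * q ^ n)) as ht.
        replace (1 - x * q ^ n + x * q ^ n) with (1 : C) in ht by ring.
        rewrite Cmod_1, (Cmod_mult x), Cmod_pow in ht; lra. }
      assert (h0 : (0 <= Cmod q ^ n <= 1)%R).
      { split; [apply pow_le; lra|].
        rewrite <- (pow1 n); apply pow_incr; lra. }
      replace (Cmod x * (1 - Cmod q ^ S n) / (1 - Cmod q))%R
        with (Cmod x * (1 - Cmod q ^ n) / (1 - Cmod q) + Cmod x * Cmod q ^ n)%R
        by (cbn; field; lra).
      set (s := (Cmod x * (1 - Cmod q ^ n) / (1 - Cmod q))%R) in *.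
      set (u := (Cmod x * Cmod q ^ n)%R) in *.
      assert (hs : (0 <= s)%R).
      { unfold s, Rdiv; apply Rmult_le_pos; [nra|].
        apply Rlt_le, Rinv_0_lt_compat; lra. }
      assert (hu0 : (0 <= u <= 1)%R) by (unfold u; nra).
      pose proof (Cmod_ge_0 (qp x q n)); nra. }
  eapply Rle_trans; [|exact h].
  assert (h0 : (0 <= Cmod q ^ n)%R) by (apply pow_le; lra).
  assert (hle : (Cmod x * (1 - Cmod q ^ n) / (1 - Cmod q) <= 1 / 2)%R).
  { apply Rmult_le_reg_r with (1 - Cmod q)%R; [lra|].
    unfold Rdiv at 1; rewrite Rmult_assoc, Rinv_l by lra; nra. }
  lra. }
(* The shifted parameter x q^N falls below the threshold, and the induction on N then peels off one
   factor at a time. Dividing by |x| + 1 instead of |x| admits x = 0. *)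
assert (hN : exists N, (Cmod x * Cmod q ^ N <= (1 - Cmod q) / 2)%R).
{ destruct (proj1 (cv_iff _ _) (cv_geom q hq) ((1 - Cmod q) / 2 / (Cmod x + 1))%R) as [N h].
  - pose proof (Cmod_ge_0 x); apply Rdiv_lt_0_compat; lra.
  - exists N; specialize (h N (le_n N)).
    replace (q ^ N - 0) with (q ^ N) in h by ring; rewrite Cmod_pow in h.
    pose proof (Cmod_ge_0 x) as hx.
    apply Rlt_le in h; apply Rmult_le_compat_l with (r := (Cmod x + 1)%R) in h; [|lra].
    replace ((Cmod x + 1) * ((1 - Cmod q) / 2 / (Cmod x + 1)))%R
      with ((1 - Cmod q) / 2)%R in h by (field; lra).
    assert (0 <= Cmod q ^ N)%R by (apply pow_le; lra); lra. }
destruct hN as [N hN]; revert x hN; induction N as [|N IH]; intros x hN hx.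
- apply hsmall; cbn in hN; lra.
- destruct (IH (x * q ^ 1)) as [m [hm h]].
  + rewrite Cpow_1_r, Cmod_mult; cbn in hN; lra.
  + apply pole_free_shift, hx.
  + exists (Rmin 1 (Cmod (1 - x) * m)); split.
    * apply Rmin_pos; [lra|]; apply Rmult_lt_0_compat; [|exact hm].
      apply Cmod_gt_0; specialize (hx 0%nat); cbn in hx; now rewrite Cmult_1_r in hx.
    * intros [|n]; [rewrite qp_0, Cmod_1; apply Rmin_l|].
      change (S n) with (1 + n)%nat; rewrite qp_add, Cmod_mult, qp_S, qp_0.
      cbn [Cpow]; eapply Rle_trans; [apply Rmin_r|].
      rewrite Cmult_1_l, !Cmult_1_r; apply Rmult_le_compat_l; [apply Cmod_ge_0|].
      specialize (h n); now rewrite Cpow_1_r in h.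
Qed.

(** The increments are - x q^n times a bounded product, so the telescoping series of increments
    converges absolutely. *)
Lemma qp_cv (x q : C) : (Cmod q < 1)%R -> qp x q ~> qpoch_inf x q.
Proof.
intros hq.
assert (hl : exists l, qp x q ~> l).
{ destruct (qp_upper x q hq) as [M [hM h]].
  destruct (ex_series_dominated (fun n => qp x q (S n) - qp x q n)
    (fun n => M * Cmod x * Cmod q ^ n)%R) as [l hl].
  - intros n; rewrite qp_S.
    replace (qp x q n * (1 - x * q ^ n) - qp x q n)
      with (- (qp x q n * (x * q ^ n))) by ring.
    rewrite Cmod_opp, !Cmod_mult, Cmod_pow, Rmult_assoc.
    apply Rmult_le_compat_r; [|apply h].
    apply Rmult_le_pos; [apply Cmod_ge_0|apply pow_le, Cmod_ge_0].
  - apply ex_series_geom_scal; split; [apply Cmod_ge_0|exact hq].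
  - exists (1 + l).
    assert (hs : (fun n => qp x q (S n)) ~> (1 + l)).
    { apply (cv_ext (fun n => 1 + Csum (fun n => qp x q (S n) - qp x q n) n)).
      - intros n; induction n as [|n IH]; [rewrite Csum_0, qp_0; ring|].
        rewrite Csum_S, Cplus_assoc, IH; ring.
      - apply cv_plus; [apply cv_const|exact hl]. }
    apply cv_iff; intros eps he; destruct (proj1 (cv_iff _ _) hs eps he) as [N hN].
    exists (S N); intros [|n] hn; [lia|]; apply hN; lia. }
destruct hl as [l hl].
assert (hlim : qp x q ~> qpoch_inf x q); [|exact hlim].
(* [lim] is specified only on Cauchy filters; the limit [l] just found serves to show that the
   filter is Cauchy. *)
apply filterlim_locally.
apply (@complete_cauchy C_CompleteNormedModule (filtermap (qp x q) eventually)).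
- apply filtermap_proper_filter, eventually_filter.
- intros eps; exists l; exact (proj1 (filterlim_locally _ _) hl eps).
Qed.

Lemma qpoch_inf_nz (x q : C) :
  (Cmod q < 1)%R -> pole_free x q -> qpoch_inf x q <> 0.
Proof.
intros hq hx e; destruct (qp_lower x q hq hx) as [m [hm h]].
pose proof (qp_cv x q hq) as hc; rewrite e in hc.
destruct (proj1 (cv_iff _ _) hc m hm) as [N hN].
specialize (hN N (le_n N)); specialize (h N).
replace (qp x q N - 0) with (qp x q N) in hN by ring; lra.
Qed.

Lemma qpoch_inf_split (x q : C) (m : nat) :
  (Cmod q < 1)%R -> qpoch_inf x q = qp x q m * qpoch_inf (x * q ^ m) q.
Proof.
intros hq; apply (cv_unique (fun n => qp x q (m + n))).
- apply cv_shift, qp_cv, hq.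
- apply (cv_ext (fun n => qp x q m * qp (x * q ^ m) q n)).
  + intros n; now rewrite qp_add.
  + apply cv_mult; [apply cv_const|apply qp_cv, hq].
Qed.

(** The two lengths are independent because later quotients compare products of different
    lengths. *)
Lemma qp_quotient_bound (x y q : C) :
  (Cmod q < 1)%R -> pole_free y q ->
  exists M, (0 < M)%R /\ forall m n, (Cmod (qp x q m / qp y q n) <= M)%R.
Proof.
intros hq hy; destruct (qp_upper x q hq) as [M [hM hu]].
destruct (qp_lower y q hq hy) as [m [hm hl]].
exists (M / m)%R; split; [apply Rdiv_lt_0_compat; lra|]; intros i j.
rewrite Cmod_div by (apply qp_nz, hy).
apply Rmult_le_compat; [apply Cmod_ge_0| |apply hu|].
- apply Rlt_le, Rinv_0_lt_compat; specialize (hl j); lra.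
- apply Rinv_le_contravar; [exact hm|apply hl].
Qed.

(** * The q-Gauss sum, by iterating c -> c q *)

Definition gauss_term (A B c q : C) (j : nat) : C :=
  qp A q j * qp B q j / (qp q q j * qp c q j) * (c / (A * B)) ^ j.

(** Uniformity in N comes from 1 / (c q^N)_j = (c)_N / (c)_(N+j): the denominators are those of the
    single parameter c. *)
Lemma gauss_term_bound (A B c q : C) :
  (Cmod q < 1)%R -> pole_free c q ->
  exists M, (0 < M)%R /\ forall N j,
    (Cmod (gauss_term A B (c * q ^ N) q j)
      <= M * Cmod (c * q ^ N / (A * B)) ^ j)%R.
Proof.
intros hq hc.
assert (hqq : pole_free q q) by (apply pole_free_small; lra).
destruct (qp_quotient_bound A q q hq hqq) as [M1 [hM1 h1]].
destruct (qp_quotient_bound B c q hq hc) as [M2 [hM2 h2]].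
destruct (qp_upper c q hq) as [M3 [hM3 h3]].
exists (M1 * M2 * M3)%R; split; [repeat apply Rmult_lt_0_compat; assumption|].
intros N j; unfold gauss_term.
assert (hN := qp_nz _ _ N hc); assert (hNj := qp_nz _ _ j (pole_free_shift _ _ N hc)).
assert (hj := qp_nz _ _ j hqq).
replace (qp A q j * qp B q j / (qp q q j * qp (c * q ^ N) q j))
  with (qp A q j / qp q q j * (qp B q j / qp c q (N + j)) * qp c q N)
  by (rewrite qp_add; field; auto).
rewrite !Cmod_mult, Cmod_pow.
apply Rmult_le_compat_r; [apply pow_le, Cmod_ge_0|].
repeat apply Rmult_le_compat; repeat apply Rmult_le_pos;
  try apply Cmod_ge_0; try rewrite <- Cmod_mult; auto.
Qed.

(** The summation certificate of the contiguous relation between the series at c and at c q. *)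
Lemma gauss_telescope (A B c q : C) (n : nat) :
  A <> 0 -> B <> 0 -> pole_free q q -> pole_free c q ->
  Csum (fun j => (1 - c) * (1 - c / (A * B)) * gauss_term A B c q j
    - (1 - c / A) * (1 - c / B) * gauss_term A B (c * q) q j) n
  = - (1 - c) * (1 - q ^ S n) * gauss_term A B c q (S n).
Proof.
intros hA hB hqq hc.
assert (hcq : forall j, qp (c * q) q j = qp c q j * (1 - c * q ^ j) / (1 - c)).
{ intros j; pose proof (qp_add c q 1 j) as h.
  change (qp c q (S j) = 1 * (1 - c * 1) * qp (c * q ^ 1) q j) in h.
  rewrite qp_S, Cpow_1_r in h; specialize (hc 0%nat); cbn [Cpow] in hc.
  rewrite h; field; intros e; apply hc; rewrite <- e; ring. }
assert (hc0 : 1 - c <> 0) by (specialize (hc 0%nat); cbn in hc; now rewrite Cmult_1_r in hc).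
assert (hz : forall j, (c * q / (A * B)) ^ j = (c / (A * B)) ^ j * q ^ j).
{ intros j; rewrite <- Cpow_mult_l; f_equal; field; auto. }
induction n as [|n IH].
- rewrite Csum_0; unfold gauss_term; rewrite hcq, !qp_S, !qp_0.
  specialize (hqq 0%nat); cbn [Cpow] in *; rewrite !Cmult_1_r in *.
  field; auto.
- rewrite Csum_S, IH; unfold gauss_term; rewrite hz, hcq, !qp_S.
  assert (h1 := qp_nz _ _ n hqq); assert (h2 := qp_nz _ _ n hc).
  assert (h3 := hqq n); assert (h4 := hqq (S n)).
  assert (h5 := hc n); assert (h6 := hc (S n)).
  clear - hA hB hc0 h1 h2 h3 h4 h5 h6.
  cbn [Cpow] in *.
  generalize dependent (qp q q n); generalize dependent (qp c q n).
  generalize (qp A q n) (qp B q n); generalize dependent (q ^ n).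
  generalize ((c / (A * B)) ^ n); intros.
  field; repeat split; auto.
Qed.

(** The boundary term of [gauss_telescope] decays like the powers of c/(AB). *)
Lemma gauss_contiguous (A B c q T U : C) :
  (Cmod q < 1)%R -> A <> 0 -> B <> 0 -> pole_free c q ->
  (Cmod (c / (A * B)) < 1)%R ->
  is_series (gauss_term A B c q) T -> is_series (gauss_term A B (c * q) q) U ->
  (1 - c) * (1 - c / (A * B)) * T = (1 - c / A) * (1 - c / B) * U.
Proof.
intros hq hA hB hc hz hT hU; apply Cminus_eq_0.
assert (hqq : pole_free q q) by (apply pole_free_small; lra).
apply (cv_unique (fun n => - (1 - c) * (1 - q ^ S n) * gauss_term A B c q (S n))).
- apply (cv_ext (fun n =>
    (1 - c) * (1 - c / (A * B)) * Csum (gauss_term A B c q) n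
    + - ((1 - c / A) * (1 - c / B)) * Csum (gauss_term A B (c * q) q) n)).
  + intros n; rewrite <- gauss_telescope by assumption.
    rewrite Csum_minus, !Csum_scal; ring.
  + unfold Cminus at 5; replace (- ((1 - c / A) * (1 - c / B) * U))
      with (- ((1 - c / A) * (1 - c / B)) * U) by ring.
    apply cv_plus; apply cv_mult; try apply cv_const; assumption.
- destruct (gauss_term_bound A B c q hq hc) as [M [hM hb]].
  replace (0 : C) with (- (1 - c) * (1 - 0) * 0) by ring.
  apply (cv_mult (fun n => - (1 - c) * (1 - q ^ S n)) (fun n => gauss_term A B c q (S n)));
    [apply (cv_mult (fun _ => - (1 - c)) (fun n => 1 - q ^ S n)); [apply cv_const|]|].
  + unfold Cminus; apply cv_plus; [apply cv_const|].
    replace (- 0) with (- (1) * 0) by ring.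
    apply (cv_ext (fun n => - (1) * q ^ S n)); [intros; ring|].
    apply cv_mult; [apply cv_const|apply (cv_shift _ _ 1), cv_geom, hq].
  + apply (cv_squeeze _ _ (fun n => M * Cmod (c / (A * B)) ^ (S n))%R).
    * intros n; specialize (hb 0%nat (S n)); cbn [Cpow] in hb; rewrite Cmult_1_r in hb.
      replace (gauss_term A B c q (S n) - 0) with (gauss_term A B c q (S n)) by ring.
      exact hb.
    * replace (Finite 0) with (Rbar_mult M 0) by (cbn; f_equal; ring).
      apply is_lim_seq_scal_l, (is_lim_seq_incr_1 (fun n => Cmod (c / (A * B)) ^ n)%R).
      apply is_lim_seq_geom; rewrite Rabs_pos_eq; [exact hz|apply Cmod_ge_0].
Qed.

(** N contiguous steps lead from c to c q^N and accumulate the first N factors of the four products.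
    As N grows, the series at c q^N tends to its first term 1. *)
Lemma gauss_sum (A B c q : C) :
  (Cmod q < 1)%R -> A <> 0 -> B <> 0 -> pole_free c q ->
  (Cmod (c / (A * B)) < 1)%R ->
  is_series (gauss_term A B c q)
    (qpoch_inf (c / A) q * qpoch_inf (c / B) q
     / (qpoch_inf c q * qpoch_inf (c / (A * B)) q)).
Proof.
intros hq hA hB hc hz; set (z := c / (A * B)) in *.
destruct (gauss_term_bound A B c q hq hc) as [M [hM hb]].
pose proof (Cmod_ge_0 z) as hz0; pose proof (Cmod_ge_0 q) as hq0.
assert (hqN : forall N, (0 <= Cmod q ^ N <= 1)%R).
{ intros N; split; [apply pow_le; lra|].
  rewrite <- (pow1 N); apply pow_incr; lra. }
assert (hzN : forall N, Cmod (c * q ^ N / (A * B)) = (Cmod z * Cmod q ^ N)%R).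
{ intros N; rewrite <- Cmod_pow, <- Cmod_mult; f_equal; unfold z; field; auto. }
assert (hb' : forall N j,
  (Cmod (gauss_term A B (c * q ^ N) q j) <= M * Cmod z ^ j)%R).
{ intros N j; eapply Rle_trans; [apply hb|].
  apply Rmult_le_compat_l; [lra|]; apply pow_incr; rewrite hzN.
  specialize (hqN N); nra. }
assert (hex : forall N, exists T : C, is_series (gauss_term A B (c * q ^ N) q) T).
{ intros N; eapply ex_series_dominated; [apply hb'|apply ex_series_geom_scal; lra]. }
(* Every term with j >= 1 contains at least one factor q^N, from the argument z q^N; this gives the
   rate |q|^N. *)
assert (hnear : forall N (T : C), is_series (gauss_term A B (c * q ^ N) q) T ->
  (Cmod (T - 1) <= M * Cmod z / (1 - Cmod z) * Cmod q ^ N)%R).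
{ intros N T hT.
  assert (hT' : is_series (fun j => gauss_term A B (c * q ^ N) q (S j)) (T - 1)).
  { apply (@is_series_incr_1 C_AbsRing C_NormedModule).
    refine (eq_ind T (is_series _) hT _ _).
    change (T = T - 1 + gauss_term A B (c * q ^ N) q 0 :> C).
    unfold gauss_term; rewrite !qp_0; cbn [Cpow]; field. }
  replace (M * Cmod z / (1 - Cmod z) * Cmod q ^ N)%R
    with (M * Cmod z * Cmod q ^ N / (1 - Cmod z))%R by (field; lra).
  apply (is_series_Cmod_le _ _ (M * Cmod z * Cmod q ^ N)%R (Cmod z)) in hT';
    [exact hT'|lra|].
  intros j; eapply Rle_trans; [apply hb|]; rewrite hzN; cbn [pow].
  replace (M * Cmod z * Cmod q ^ N * Cmod z ^ j)%R
    with (M * (Cmod z * Cmod q ^ N * Cmod z ^ j))%R by ring.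
  specialize (hqN N); apply Rmult_le_compat_l; [lra|].
  apply Rmult_le_compat_l; [nra|]; apply pow_incr; nra. }
destruct (hex 0%nat) as [T0 hT0]; cbn [Cpow] in hT0; rewrite Cmult_1_r in hT0.
(* The relation is kept free of division, since (c/A)_N and (c/B)_N may vanish. Only the limits of
   (c)_N and (z)_N are divided out at the end. *)
assert (hiter : forall N, exists T : C, is_series (gauss_term A B (c * q ^ N) q) T /\
  qp c q N * qp z q N * T0 = qp (c / A) q N * qp (c / B) q N * T).
{ induction N as [|N [T [hT IH]]].
  - exists T0; cbn [Cpow]; rewrite Cmult_1_r, !qp_0; split; [exact hT0|ring].
  - destruct (hex (S N)) as [U hU]; exists U; split; [exact hU|].
    assert (hcN : c * q ^ S N = c * q ^ N * q) by (cbn [Cpow]; ring).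
    rewrite hcN in hU; rewrite !qp_S.
    assert (h := gauss_contiguous A B (c * q ^ N) q T U hq hA hB
      (pole_free_shift _ _ _ hc)).
    rewrite hzN in h; specialize (h ltac:(specialize (hqN N); nra) hT hU).
    replace (c * q ^ N / (A * B)) with (z * q ^ N) in h by (unfold z; field; auto).
    replace (c * q ^ N / A) with (c / A * q ^ N) in h by (field; auto).
    replace (c * q ^ N / B) with (c / B * q ^ N) in h by (field; auto).
    transitivity (qp c q N * qp z q N * T0 * ((1 - c * q ^ N) * (1 - z * q ^ N))); [ring|].
    rewrite IH.
    transitivity (qp (c / A) q N * qp (c / B) q N
      * ((1 - c * q ^ N) * (1 - z * q ^ N) * T)); [ring|].
    rewrite h; ring. }
assert (hlim : qpoch_inf c q * qpoch_inf z q * T0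
  = qpoch_inf (c / A) q * qpoch_inf (c / B) q).
{ apply (cv_unique (fun N => qp c q N * qp z q N * T0)).
  { apply (cv_mult (fun N => qp c q N * qp z q N) (fun _ => T0)); [|apply cv_const].
    apply cv_mult; apply qp_cv; exact hq. }
  apply (cv_ext (fun N => qp (c / A) q N * qp (c / B) q N
    + (qp c q N * qp z q N * T0 - qp (c / A) q N * qp (c / B) q N))); [intros; ring|].
  rewrite <- (Cplus_0_r (qpoch_inf (c / A) q * _)); apply cv_plus.
  { apply cv_mult; apply qp_cv; assumption. }
  destruct (qp_upper (c / A) q hq) as [M1 [hM1 h1]].
  destruct (qp_upper (c / B) q hq) as [M2 [hM2 h2]].
  apply (cv_squeeze _ _ (fun N => M1 * M2 * (M * Cmod z / (1 - Cmod z)) * Cmod q ^ N)%R).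
  - intros N; destruct (hiter N) as [T [hT e]]; rewrite e.
    replace (qp (c / A) q N * qp (c / B) q N * T - qp (c / A) q N * qp (c / B) q N - 0)
      with (qp (c / A) q N * qp (c / B) q N * (T - 1)) by ring.
    rewrite !Cmod_mult, (Rmult_assoc (M1 * M2)).
    apply Rmult_le_compat; [apply Rmult_le_pos; apply Cmod_ge_0|apply Cmod_ge_0| |].
    + apply Rmult_le_compat; auto using Cmod_ge_0.
    + apply hnear, hT.
  - replace (Finite 0)
      with (Rbar_mult (M1 * M2 * (M * Cmod z / (1 - Cmod z)))%R 0) by (cbn; f_equal; ring).
    apply is_lim_seq_scal_l, is_lim_seq_geom; rewrite Rabs_pos_eq; lra. }
replace (qpoch_inf (c / A) q * qpoch_inf (c / B) q / (qpoch_inf c q * qpoch_inf z q))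
  with T0; [exact hT0|].
rewrite <- hlim; field.
split; apply qpoch_inf_nz; auto; apply pole_free_small; lra.
Qed.

(** * The folded series *)

(** Exposes multiplication and equality in [C], so that [field] recognises the goal. *)
Ltac scal_to_Cmult :=
  change (@scal C_AbsRing C_NormedModule) with Cmult;
  match goal with |- ?u = ?v => change (@eq C u v) end.

Lemma very_well_bound (p q : C) :
  (Cmod q < 1)%R -> (Cmod p <= 1)%R ->
  exists M, (0 < M)%R /\ forall k, (Cmod (very_well p q k) <= M)%R.
Proof.
intros hq hp; pose proof (Cmod_ge_0 q); pose proof (Cmod_ge_0 p).
destruct (qp_quotient_bound (p * q) q q hq) as [M [hM h]].
{ apply pole_free_small; lra. }
exists (1 + 2 * M)%R; split; [lra|]; intros [|j]; cbn [very_well].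
- rewrite Cmod_1; lra.
- specialize (h j (S j)).
  unfold Cdiv in *; rewrite <- Cmult_assoc, Cmod_mult.
  assert (h2 : (Cmod (1 - p * (q ^ S j * q ^ S j)) <= 2)%R).
  { eapply Rle_trans; [apply Cmod_triangle|].
    rewrite Cmod_1, Cmod_opp, !Cmod_mult, Cmod_pow.
    assert (hqj : (0 <= Cmod q ^ S j <= 1)%R).
    { split; [apply pow_le; lra|rewrite <- (pow1 (S j)); apply pow_incr; lra]. }
    set (t := (Cmod q ^ S j)%R) in *.
    assert (t * t <= 1)%R by nra; assert (0 <= t * t)%R by nra; nra. }
  pose proof (Cmod_ge_0 (1 - p * (q ^ S j * q ^ S j))).
  pose proof (Cmod_ge_0 (qp (p * q) q j * / qp q q (S j))).
  nra.
Qed.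

Lemma well_poised3_bound (p q b c d : C) :
  (Cmod q < 1)%R -> pole_free (p * q / b) q -> pole_free (p * q / c) q ->
  pole_free (p * q / d) q ->
  exists M, (0 < M)%R /\ forall k, (Cmod (well_poised3 p q b c d k) <= M)%R.
Proof.
intros hq hb hc hd.
destruct (qp_quotient_bound b _ q hq hb) as [M1 [hM1 h1]].
destruct (qp_quotient_bound c _ q hq hc) as [M2 [hM2 h2]].
destruct (qp_quotient_bound d _ q hq hd) as [M3 [hM3 h3]].
exists (M1 * M2 * M3)%R; split; [repeat apply Rmult_lt_0_compat; assumption|].
intros k; unfold well_poised3.
match goal with |- (Cmod ?t <= _)%R =>
  replace t with (qp b q k / qp (p * q / b) q k * (qp c q k / qp (p * q / c) q k)
    * (qp d q k / qp (p * q / d) q k)) end.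
- rewrite !Cmod_mult; repeat apply Rmult_le_compat; auto using Cmod_ge_0.
  apply Rmult_le_pos; apply Cmod_ge_0.
- field; repeat split; apply qp_nz; assumption.
Qed.

(** This is the bilateral term itself at index k >= 0. The factor [very_well] accounts for its
    reflected partner, up to a constant 1 - q in case (ii). *)
Definition folded_term (p q a b c d : C) (k : nat) : C :=
  qp a q (2 * k) / qp (p ^ 2 * q / a) q (2 * k) * well_poised3 p q b c d k
  * (p * q / a) ^ k.

Definition phi_coef (p q a b c d : C) (n : nat) : C :=
  qp a q n * qp (a * b / p) q n * qp (a * c / p) q n * qp (a * d / p) q n
  / (qp q q n * qp (p * q / b) q n * qp (p * q / c) q n * qp (p * q / d) q n).

(** q-Gauss after splitting 2k factors off (a)_(2k+j) and (p q)_(2k+j). Of the four infinite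
    products two depend on k, and [qpoch_inf_split] turns this dependence into finite products. *)
Lemma kernel_sum (p q a : C) (k : nat) :
  (0 < Cmod q < 1)%R -> p <> 0 -> (Cmod p <= 1)%R -> a <> 0 ->
  (Cmod (p * q / a) < 1)%R -> (Cmod (p ^ 2 * q / a ^ 2) < 1)%R ->
  is_series (fun j => kernel p q a k j * (p ^ 2 * q / a ^ 2) ^ j)
    (qp a q (2 * k) / qp (p ^ 2 * q / a) q (2 * k)
     * (qpoch_inf (p ^ 2 * q / a) q * qpoch_inf (p * q / a) q
        / (qpoch_inf (p * q) q * qpoch_inf (p ^ 2 * q / a ^ 2) q))).
Proof.
intros [hq0 hq] hp0 hp ha hpa hz; apply Cmod_gt_0 in hq0.
pose proof (Cmod_ge_0 q); pose proof (Cmod_ge_0 p).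
assert (hpq : pole_free (p * q) q).
{ apply pole_free_small; [lra|]; rewrite Cmod_mult; nra. }
assert (hqq : pole_free q q) by (apply pole_free_small; lra).
assert (hppa : pole_free (p ^ 2 * q / a) q).
{ apply pole_free_small; [lra|].
  replace (p ^ 2 * q / a) with (p * (p * q / a)) by (field; auto).
  rewrite Cmod_mult; pose proof (Cmod_ge_0 (p * q / a)); nra. }
assert (hqk : q ^ (2 * k) <> 0) by (apply Cpow_nz, hq0).
set (x := q ^ (2 * k)) in *.
assert (ez : p * q * x / (a / p * (a * x)) = p ^ 2 * q / a ^ 2) by (field; auto).
assert (hg := gauss_sum (a / p) (a * x) (p * q * x) q hq).
rewrite ez in hg.
specialize (hg ltac:(apply Cmult_neq_0; [exact ha|]; intros e; apply (C1_nz);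
  replace (1 : C) with (p * / p) by (field; auto); rewrite e; ring)
  ltac:(apply Cmult_neq_0; auto) (pole_free_shift _ _ _ hpq) hz).
replace (p * q * x / (a / p)) with (p ^ 2 * q / a * x) in hg by (field; auto).
replace (p * q * x / (a * x)) with (p * q / a) in hg by (field; auto).
apply (@is_series_scal C_AbsRing C_NormedModule
  (qp a q (2 * k) / qp (p * q) q (2 * k))) in hg.
match type of hg with is_series _ ?v => match goal with |- is_series _ ?u =>
  assert (e : u = v) end end.
{ rewrite (qpoch_inf_split (p ^ 2 * q / a) q (2 * k) hq).
  rewrite (qpoch_inf_split (p * q) q (2 * k) hq); fold x.
  scal_to_Cmult.
  field; repeat split; try apply qp_nz; try apply qpoch_inf_nz; auto.
  - apply pole_free_small; lra.
  - apply pole_free_shift, hpq. }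
rewrite e; revert hg; apply is_series_ext; intros j.
scal_to_Cmult.
unfold gauss_term, kernel; rewrite ez, !qp_add; fold x.
field; repeat split; apply qp_nz; auto; apply pole_free_shift, hpq.
Qed.

Lemma folded_term_bound (p q a b c d : C) :
  (0 < Cmod q < 1)%R -> (Cmod p <= 1)%R -> a <> 0 -> (Cmod (p * q / a) < 1)%R ->
  pole_free (p * q / b) q -> pole_free (p * q / c) q -> pole_free (p * q / d) q ->
  exists M, (0 < M)%R /\
    forall k, (Cmod (folded_term p q a b c d k) <= M * Cmod (p * q / a) ^ k)%R.
Proof.
intros [hq0 hq] hp ha hpa hb hc hd.
pose proof (Cmod_ge_0 q); pose proof (Cmod_ge_0 p).
assert (hppa : pole_free (p ^ 2 * q / a) q).
{ apply pole_free_small; [lra|].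
  replace (p ^ 2 * q / a) with (p * (p * q / a)) by (field; auto).
  rewrite Cmod_mult; pose proof (Cmod_ge_0 (p * q / a)); nra. }
destruct (qp_quotient_bound a _ q hq hppa) as [M1 [hM1 h1]].
destruct (well_poised3_bound p q b c d hq hb hc hd) as [M2 [hM2 h2]].
exists (M1 * M2)%R; split; [apply Rmult_lt_0_compat; assumption|].
intros k; unfold folded_term; rewrite 2!Cmod_mult, Cmod_pow.
apply Rmult_le_compat_r; [apply pow_le, Cmod_ge_0|].
apply Rmult_le_compat; auto using Cmod_ge_0.
Qed.

(** Convergence of the 4-phi-3 series is part of the result: by Jackson's sum its N-th partial sum
    is the triangular double sum to which Tannery's theorem is applied. *)
Lemma folded_transformation (p q a b c d : C) :
  (0 < Cmod q < 1)%R -> p <> 0 -> (Cmod p <= 1)%R -> a <> 0 -> b <> 0 -> c <> 0 ->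
  a * b * c * d = p ^ 2 * q ->
  (Cmod (p * q / a) < 1)%R -> (Cmod (p ^ 2 * q / a ^ 2) < 1)%R ->
  pole_free (p * q / b) q -> pole_free (p * q / c) q -> pole_free (p * q / d) q ->
  exists S : C,
    is_series (fun n => phi_coef p q a b c d n * (p ^ 2 * q / a ^ 2) ^ n) S /\
    is_series (fun k => very_well p q k * folded_term p q a b c d k)
      (qpoch_inf (p * q) q * qpoch_inf (p ^ 2 * q / a ^ 2) q
       / (qpoch_inf (p * q / a) q * qpoch_inf (p ^ 2 * q / a) q) * S).
Proof.
intros hq hp0 hp ha hb hc habcd hpa hz Hb Hc Hd.
pose proof (Cmod_ge_0 q); pose proof (Cmod_ge_0 p).
assert (hq0 : q <> 0) by (apply Cmod_gt_0, hq).
assert (hpq : pole_free (p * q) q).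
{ apply pole_free_small; [lra|]; rewrite Cmod_mult; nra. }
assert (hqq : pole_free q q) by (apply pole_free_small; lra).
assert (hppa : (Cmod (p ^ 2 * q / a) < 1)%R).
{ replace (p ^ 2 * q / a) with (p * (p * q / a)) by (field; auto).
  rewrite Cmod_mult; pose proof (Cmod_ge_0 (p * q / a)); nra. }
set (z := p ^ 2 * q / a ^ 2) in *.
(* In z^n = z^k z^j the factor z^k joins (a/p)^k to form (p q/a)^k, the argument of the bilateral
   series. *)
set (w := fun k => very_well p q k * well_poised3 p q b c d k * (p * q / a) ^ k).
assert (hw : forall k, very_well p q k * well_poised3 p q b c d k * (a / p) ^ k * z ^ k
  = w k).
{ intros k; unfold w; rewrite <- Cmult_assoc, <- Cpow_mult_l; do 2 f_equal.
  unfold z; field; auto. }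
set (P := qpoch_inf (p ^ 2 * q / a) q * qpoch_inf (p * q / a) q
  / (qpoch_inf (p * q) q * qpoch_inf z q)).
set (g := fun k => qp a q (2 * k) / qp (p ^ 2 * q / a) q (2 * k) * P).
assert (hg : forall k, is_series (fun j => kernel p q a k j * z ^ j) (g k))
  by (intros k; apply kernel_sum; auto).
destruct (very_well_bound p q ltac:(lra) hp) as [M1 [hM1 h1]].
destruct (well_poised3_bound p q b c d ltac:(lra) Hb Hc Hd) as [M2 [hM2 h2]].
destruct (qp_quotient_bound (a / p) q q ltac:(lra) hqq) as [M3 [hM3 h3]].
destruct (qp_quotient_bound a (p * q) q ltac:(lra) hpq) as [M4 [hM4 h4]].
pose proof (Cmod_ge_0 z) as hz0; pose proof (Cmod_ge_0 (p * q / a)) as hpa0.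
assert (hker : forall k n,
  (Cmod (Csum (fun j => kernel p q a k j * z ^ j)%C n) <= M3 * M4 / (1 - Cmod z))%R).
{ intros k n; apply Csum_geom_le; [lra|]; intros j.
  rewrite Cmod_mult, Cmod_pow; apply Rmult_le_compat_r; [apply pow_le; lra|].
  replace (kernel p q a k j) with (qp (a / p) q j / qp q q j
    * (qp a q (2 * k + j) / qp (p * q) q (2 * k + j)))
    by (unfold kernel; field; split; apply qp_nz; assumption).
  rewrite Cmod_mult; apply Rmult_le_compat; auto using Cmod_ge_0. }
(* Row k of the triangle k + j <= N, extended by 0 because domination is required for every k. *)
set (F := fun N k => if (k <=? N)%nat
  then w k * Csum (fun j => kernel p q a k j * z ^ j) (N - k) else 0).
destruct (tannery F (fun k => w k * g k)
  (fun k => M1 * M2 * (M3 * M4 / (1 - Cmod z)) * Cmod (p * q / a) ^ k)%R)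
  as [S [hS1 hS2]].
- apply ex_series_geom_scal; lra.
- intros N k; unfold F.
  assert (hK : (0 <= M3 * M4 / (1 - Cmod z))%R).
  { apply Rlt_le, Rdiv_lt_0_compat; [apply Rmult_lt_0_compat; assumption|lra]. }
  assert (hpk : (0 <= Cmod (p * q / a) ^ k)%R) by (apply pow_le; lra).
  destruct (k <=? N)%nat.
  + unfold w; rewrite !Cmod_mult, Cmod_pow.
    replace (M1 * M2 * (M3 * M4 / (1 - Cmod z)) * Cmod (p * q / a) ^ k)%R
      with (M1 * M2 * Cmod (p * q / a) ^ k * (M3 * M4 / (1 - Cmod z)))%R by ring.
    apply Rmult_le_compat; auto using Cmod_ge_0.
    * repeat apply Rmult_le_pos; auto using Cmod_ge_0.
    * apply Rmult_le_compat_r; [exact hpk|].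
      apply Rmult_le_compat; auto using Cmod_ge_0.
  + rewrite Cmod_0; apply Rmult_le_pos; [|exact hpk].
    apply Rmult_le_pos; [nra|exact hK].
- intros k; apply cv_iff; intros eps he.
  assert (hc' : (fun n => w k * Csum (fun j => kernel p q a k j * z ^ j) n) ~> (w k * g k))
    by (apply cv_mult; [apply cv_const|apply hg]).
  destruct (proj1 (cv_iff _ _) hc' eps he) as [N hN].
  exists (N + k)%nat; intros n hn; unfold F.
  replace (k <=? n)%nat with true by (symmetry; apply Nat.leb_le; lia).
  apply hN; lia.
- exists S; split.
  + apply is_series_cv; revert hS2; apply cv_ext; intros N.
    transitivity (Csum (fun k =>
      Csum (fun j => w k * (kernel p q a k j * z ^ j)) (N - k)) N).
    { apply Csum_ext; intros k hk; unfold F.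
      replace (k <=? N)%nat with true by (symmetry; apply Nat.leb_le; lia).
      now rewrite Csum_scal. }
    rewrite <- (sum_triangle_swap (fun k j => w k * (kernel p q a k j * z ^ j))).
    apply Csum_ext; intros n _; unfold phi_coef.
    rewrite <- jackson_sum, Cmult_comm, <- Csum_scal by assumption.
    apply Csum_ext; intros k hk; rewrite <- hw; unfold jackson_term.
    replace n with (k + (n - k))%nat at 3 by lia; rewrite Cpow_add_r; ring.
  + apply (@is_series_scal C_AbsRing C_NormedModule (/ P)) in hS1.
    assert (hnz : forall x, (Cmod x < 1)%R -> qpoch_inf x q <> 0).
    { intros x hx; apply qpoch_inf_nz; [lra|]; apply pole_free_small; lra. }
    assert (hP : P <> 0).
    { unfold P, Cdiv; apply Cmult_neq_0; [apply Cmult_neq_0; apply hnz; assumption|].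
      intros e; apply C1_nz.
      assert (hden : qpoch_inf (p * q) q * qpoch_inf z q <> 0).
      { apply Cmult_neq_0; apply hnz; [rewrite Cmod_mult; nra|assumption]. }
      rewrite <- (Cinv_r _ hden), e; ring. }
    match goal with |- is_series _ ?u =>
      assert (e : u = @scal C_AbsRing C_NormedModule (/ P) S) end.
    { scal_to_Cmult; unfold P; field.
      repeat split; apply hnz; try assumption; rewrite Cmod_mult; nra. }
    rewrite e; revert hS1; apply is_series_ext; intros k.
    scal_to_Cmult.
    unfold g, w, folded_term; field; split; [|exact hP].
    apply qp_nz, pole_free_small; [lra|exact hppa].
Qed.

(** * Reflection of the bilateral terms *)

Definition neg_qp (x q : C) (n : nat) : C := Cprod (fun i => 1 - x / q ^ S i) n.

Lemma neg_qp_S (x q : C) (n : nat) :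
  neg_qp x q (S n) = neg_qp x q n * (1 - x / q ^ S n).
Proof. reflexivity. Qed.

Lemma neg_qp_nz (x q : C) (n : nat) :
  (forall i, 1 - x / q ^ S i <> 0) -> neg_qp x q n <> 0.
Proof.
intros h; induction n as [|n IH]; [exact C1_nz|].
rewrite neg_qp_S; apply Cmult_neq_0; auto.
Qed.

Lemma qpoch_of_nat (x q : C) (n : nat) : qpoch x q (Z.of_nat n) = qp x q n.
Proof.
destruct n as [|n]; [reflexivity|].
cbn [Z.of_nat qpoch]; now rewrite SuccNat2Pos.id_succ.
Qed.

Lemma qpoch_opp_of_nat (x q : C) (n : nat) :
  qpoch x q (- Z.of_nat n) = / neg_qp x q n.
Proof.
destruct n as [|n]; [unfold neg_qp; cbn; field; exact C1_nz|].
cbn [Z.of_nat Z.opp qpoch]; now rewrite SuccNat2Pos.id_succ.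
Qed.

Lemma Cpowz_of_nat (z : C) (n : nat) : Cpowz z (Z.of_nat n) = z ^ n.
Proof.
destruct n as [|n]; [reflexivity|].
cbn [Z.of_nat Cpowz]; now rewrite SuccNat2Pos.id_succ.
Qed.

Lemma Cpowz_opp_of_nat (z : C) (n : nat) : Cpowz z (- Z.of_nat n) = / z ^ n.
Proof.
destruct n as [|n]; [cbn; field; exact C1_nz|].
cbn [Z.of_nat Z.opp Cpowz]; now rewrite SuccNat2Pos.id_succ.
Qed.

(** A root and its negative pair up to (a;q^2)_n and (q a;q^2)_n, the factors of even and odd index
    of (a;q)_(2n). *)
Lemma qp_duplication (q a s t : C) (n : nat) :
  s ^ 2 = a -> t ^ 2 = q * a ->
  qp s q n * qp (- s) q n * qp t q n * qp (- t) q n = qp a q (2 * n).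
Proof.
intros hs ht; induction n as [|n IH]; [cbn [Nat.mul Nat.add]; rewrite !qp_0; ring|].
replace (2 * S n)%nat with (S (S (2 * n))) by lia; rewrite !qp_S, <- IH.
replace (a * q ^ (2 * n)) with (s ^ 2 * (q ^ n * q ^ n))
  by (rewrite hs, <- Cpow_add_r; do 2 f_equal; lia).
replace (a * q ^ S (2 * n)) with (t ^ 2 * (q ^ n * q ^ n))
  by (rewrite ht, <- Cpow_add_r; replace (n + n)%nat with (2 * n)%nat by lia;
      cbn [Cpow]; ring).
ring.
Qed.

Lemma neg_qp_duplication (q a s t : C) (n : nat) :
  q <> 0 -> s ^ 2 = a -> t ^ 2 = q * a ->
  neg_qp s q n * neg_qp (- s) q n * neg_qp t q n * neg_qp (- t) q n
  = neg_qp a q (2 * n).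
Proof.
intros hq hs ht; induction n as [|n IH]; [unfold neg_qp; cbn; ring|].
replace (2 * S n)%nat with (S (S (2 * n))) by lia; rewrite !neg_qp_S, <- IH.
assert (hqn : q ^ n <> 0) by (apply Cpow_nz, hq).
assert (e2 : q ^ (2 * n) = q ^ n * q ^ n)
  by (rewrite <- Cpow_add_r; f_equal; lia).
replace (a / q ^ S (2 * n)) with (t ^ 2 / (q ^ S n * q ^ S n))
  by (rewrite ht; cbn [Cpow]; rewrite e2; field; auto).
replace (a / q ^ S (S (2 * n))) with (s ^ 2 / (q ^ S n * q ^ S n))
  by (rewrite hs; cbn [Cpow]; rewrite e2; field; auto).
cbn [Cpow]; field; auto.
Qed.

(** [psi_defined] speaks only of the roots. A factor of a with odd exponent of q splits into those
    of t and - t, one with even exponent into those of s and - s. *)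
Lemma neg_factor_nz (q a s t : C) :
  q <> 0 -> s ^ 2 = a -> t ^ 2 = q * a ->
  (forall x, In x [s; - s; t; - t] -> forall i, 1 - x / q ^ S i <> 0) ->
  forall i, 1 - a / q ^ S i <> 0.
Proof.
intros hq hs ht h i.
assert (hqn : forall n, q ^ n <> 0) by (intros; apply Cpow_nz, hq).
destruct (Nat.Even_or_Odd i) as [[m e]|[m e]]; subst i.
- replace (1 - a / q ^ S (2 * m)) with ((1 - t / q ^ S m) * (1 - - t / q ^ S m)).
  + apply Cmult_neq_0; apply h; cbn; auto.
  + transitivity (1 - t ^ 2 / (q ^ S m * q ^ S m)); [field; auto|].
    rewrite ht, <- Cpow_add_r; replace (S m + S m)%nat with (S (S (2 * m))) by lia.
    rewrite (Cpow_S q (S (2 * m))); field; auto.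
- replace (1 - a / q ^ S (2 * m + 1)) with ((1 - s / q ^ S m) * (1 - - s / q ^ S m)).
  + apply Cmult_neq_0; apply h; cbn; auto.
  + transitivity (1 - s ^ 2 / (q ^ S m * q ^ S m)); [field; auto|].
    rewrite hs, <- Cpow_add_r; do 3 f_equal; lia.
Qed.

(** Since q^(s+l+1) = x y q^l, one has 1 - y / q^(s+l+1) = - (1 - x q^l) / (x q^l), and likewise
    with x and y exchanged. Only the first s factors are left unreflected. *)
Lemma neg_qp_reflection (x y q : C) (s l : nat) :
  q <> 0 -> x <> 0 -> y <> 0 -> x * y = q ^ S s ->
  neg_qp y q (s + l) * neg_qp x q s * qp y q l
  = neg_qp y q s * (y / x) ^ l * qp x q l * neg_qp x q (s + l).
Proof.
intros hq hx hy hxy.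
assert (hqn : forall n, q ^ n <> 0) by (intros; apply Cpow_nz, hq).
induction l as [|l IH]; [rewrite Nat.add_0_r, !qp_0; cbn [Cpow]; ring|].
rewrite Nat.add_succ_r, !neg_qp_S, !qp_S.
replace (q ^ S (s + l)) with (x * y * q ^ l) by (rewrite hxy, <- Cpow_add_r; f_equal; lia).
rewrite Cpow_S.
transitivity (neg_qp y q (s + l) * neg_qp x q s * qp y q l
  * ((1 - y / (x * y * q ^ l)) * (1 - y * q ^ l))); [ring|].
rewrite IH; field; auto.
Qed.

(** Here y is q/a or q^3/a. The lower parameter q/s or q^2/s is a root of q y rather than of y,
    hence the order of u and v. *)
Lemma psi_term_of_nat (q a y s t u v b c d b' c' d' z : C) (k : nat) :
  s ^ 2 = a -> t ^ 2 = q * a -> v ^ 2 = y -> u ^ 2 = q * y ->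
  psi_term [s; - s; t; - t; b; c; d] [u; - u; v; - v; b'; c'; d'] q z (Z.of_nat k)
  = qp a q (2 * k) / qp y q (2 * k)
    * (qp b q k * qp c q k * qp d q k / (qp b' q k * qp c' q k * qp d' q k)) * z ^ k.
Proof.
intros hs ht hv hu; unfold psi_term, qpochs, Cprod_list; cbn [map fold_right].
rewrite !Cmult_1_r.
rewrite !qpoch_of_nat, Cpowz_of_nat.
rewrite <- (qp_duplication q a s t), <- (qp_duplication q y v u) by assumption.
unfold Cdiv; rewrite !Cinv_mult; ring.
Qed.

Lemma psi_term_opp_of_nat (q a y s t u v b c d b' c' d' z : C) (k : nat) :
  q <> 0 -> s ^ 2 = a -> t ^ 2 = q * a -> v ^ 2 = y -> u ^ 2 = q * y ->
  psi_term [s; - s; t; - t; b; c; d] [u; - u; v; - v; b'; c'; d'] q z (- Z.of_nat k)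
  = neg_qp y q (2 * k) / neg_qp a q (2 * k)
    * (neg_qp b' q k * neg_qp c' q k * neg_qp d' q k
       / (neg_qp b q k * neg_qp c q k * neg_qp d q k)) / z ^ k.
Proof.
intros hq hs ht hv hu; unfold psi_term, qpochs, Cprod_list; cbn [map fold_right].
rewrite !Cmult_1_r.
rewrite !qpoch_opp_of_nat, Cpowz_opp_of_nat.
rewrite <- (neg_qp_duplication q a s t), <- (neg_qp_duplication q y v u) by assumption.
unfold Cdiv; rewrite !Cinv_mult, !Cinv_inv.
ring.
Qed.

Lemma neg_qp_ratio (x y q : C) (s l : nat) :
  q <> 0 -> x <> 0 -> y <> 0 -> x * y = q ^ S s ->
  (forall i, 1 - x / q ^ S i <> 0) -> pole_free y q ->
  neg_qp y q (s + l) / neg_qp x q (s + l)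
  = neg_qp y q s / neg_qp x q s * (y / x) ^ l * (qp x q l / qp y q l).
Proof.
intros hq hx hy hxy hnx hny.
assert (h1 := neg_qp_nz x q (s + l) hnx); assert (h2 := neg_qp_nz x q s hnx).
assert (h3 := qp_nz y q l hny).
transitivity (neg_qp y q (s + l) * neg_qp x q s * qp y q l
  / (neg_qp x q (s + l) * neg_qp x q s * qp y q l)); [field; auto|].
rewrite neg_qp_reflection by assumption; field; auto.
Qed.

Lemma factors_nz (a b c d e : C) :
  a * b * c * d = e -> e <> 0 -> a <> 0 /\ b <> 0 /\ c <> 0 /\ d <> 0.
Proof.
intros h he; repeat split; intros ->; apply he; rewrite <- h; ring.
Qed.

(** This is the weight of a pair k, -k. At k = 0 [very_well] is 1 and not 2, as the central term has
    no partner. *)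
Lemma very_well_1 (q : C) (k : nat) :
  (0 < Cmod q < 1)%R -> very_well 1 q (S k) = 1 + q ^ S k.
Proof.
intros hq; assert (hqq : pole_free q q) by (apply pole_free_small; lra).
cbn [very_well]; rewrite Cmult_1_l, Cmult_1_l, qp_S.
assert (h1 := qp_nz _ _ k hqq); assert (h2 := hqq k); cbn [Cpow]; field; auto.
Qed.

Lemma very_well_q (q : C) (k : nat) :
  (0 < Cmod q < 1)%R -> (1 - q) * very_well q q k = 1 - q * (q ^ k * q ^ k).
Proof.
intros hq; assert (hqq : pole_free q q) by (apply pole_free_small; lra).
destruct k as [|k]; cbn [very_well]; [cbn [Cpow]; ring|].
pose proof (qp_add q q 1 k) as h; change (1 + k)%nat with (S k) in h.
assert (h1 := qp_nz _ _ (S k) hqq); rewrite h in *.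
change (qp q q 1) with (1 * (1 - q * 1)) in *; rewrite Cpow_1_r in *.
assert (h2 : qp (q * q) q k <> 0) by (intros e; apply h1; rewrite e; ring).
assert (h3 : 1 - q <> 0) by (intros e; apply h1; rewrite !Cmult_1_r, e; ring).
field; auto.
Qed.

Lemma folded_term_series (p q a b c d : C) :
  (0 < Cmod q < 1)%R -> (Cmod p <= 1)%R -> a <> 0 -> (Cmod (p * q / a) < 1)%R ->
  pole_free (p * q / b) q -> pole_free (p * q / c) q -> pole_free (p * q / d) q ->
  exists l : C, is_series (folded_term p q a b c d) l.
Proof.
intros hq hp ha hpa hb hc hd.
destruct (folded_term_bound p q a b c d) as [M [hM h]]; try assumption.
eapply ex_series_dominated; [exact h|].
apply ex_series_geom_scal; split; [apply Cmod_ge_0|exact hpa].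
Qed.

(** Gathers the geometric factors that reflection produces. W is q in case (i) and q^2 in case (ii),
    by the condition on a b c d. *)
Lemma pow_regroup (Y X1 X2 X3 Z W : C) (k : nat) :
  Z <> 0 -> Y * Y * X1 * X2 * X3 = W * Z * Z ->
  Y ^ (2 * k) * X1 ^ k * X2 ^ k * X3 ^ k / Z ^ k = W ^ k * Z ^ k.
Proof.
intros hZ h; assert (hZk := Cpow_nz Z k hZ).
replace (2 * k)%nat with (k + k)%nat by lia; rewrite Cpow_add_r.
rewrite <- !Cpow_mult_l, h, !Cpow_mult_l; field; exact hZk.
Qed.

Lemma psi_reflection_1 (q a s t u v b c d : C) (k : nat) :
  q <> 0 -> q = a * b * c * d ->
  s ^ 2 = a -> t ^ 2 = q * a -> v ^ 2 = q / a -> u ^ 2 = q * (q / a) ->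
  pole_free (q / a) q ->
  let xs := [s; - s; t; - t; b; c; d] in
  let cs := [u; - u; v; - v; q / b; q / c; q / d] in
  psi_defined xs cs q ->
  psi_term xs cs q (q / a) (- Z.of_nat k)
  = q ^ k * psi_term xs cs q (q / a) (Z.of_nat k).
Proof.
intros hq habcd hs ht hv hu hY xs cs [hcs hxs]; subst xs cs.
destruct (factors_nz a b c d q (eq_sym habcd) hq) as [ha [hb [hc hd]]].
rewrite (psi_term_of_nat q a (q / a)), (psi_term_opp_of_nat q a (q / a)) by assumption.
assert (hna := neg_factor_nz q a s t hq hs ht
  (fun x hx => hxs x ltac:(cbn [In] in *; tauto))).
assert (ratio : forall (x : C) m, x <> 0 -> (forall i, 1 - x / q ^ S i <> 0) ->
  pole_free (q / x) q ->
  neg_qp (q / x) q m / neg_qp x q m = (q / x / x) ^ m * (qp x q m / qp (q / x) q m)).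
{ intros x m hx hnx hpx; pose proof (neg_qp_ratio x (q / x) q 0 m hq hx) as h.
  cbn [Nat.add] in h; rewrite h; try assumption.
  - unfold neg_qp; cbn [Cprod]; field.
    apply qp_nz; assumption.
  - unfold Cdiv; apply Cmult_neq_0; [exact hq|].
    intros e; apply C1_nz; rewrite <- (Cinv_r x hx), e; ring.
  - cbn [Cpow]; field; exact hx. }
assert (Hb : pole_free (q / b) q) by (exact (hcs (q / b) ltac:(cbn [In]; tauto))).
assert (Hc : pole_free (q / c) q) by (exact (hcs (q / c) ltac:(cbn [In]; tauto))).
assert (Hd : pole_free (q / d) q) by (exact (hcs (q / d) ltac:(cbn [In]; tauto))).
assert (hnb := hxs b ltac:(cbn [In]; tauto)); assert (hnc := hxs c ltac:(cbn [In]; tauto)).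
assert (hnd := hxs d ltac:(cbn [In]; tauto)).
rewrite ratio by assumption.
transitivity ((q / a / a) ^ (2 * k) * (qp a q (2 * k) / qp (q / a) q (2 * k))
  * (neg_qp (q / b) q k / neg_qp b q k * (neg_qp (q / c) q k / neg_qp c q k)
    * (neg_qp (q / d) q k / neg_qp d q k)) / (q / a) ^ k).
{ unfold Cdiv; rewrite !Cinv_mult; ring. }
rewrite !ratio by assumption.
assert (hz : q / a <> 0).
{ intros e; apply hq; transitivity (q / a * a); [field; exact ha|rewrite e; ring]. }
pose proof (pow_regroup (q / a / a) (q / b / b) (q / c / c) (q / d / d) (q / a) q k hz) as hr.
transitivity (((q / a / a) ^ (2 * k) * (q / b / b) ^ k * (q / c / c) ^ k * (q / d / d) ^ k
  / (q / a) ^ k) * (qp a q (2 * k) / qp (q / a) q (2 * k)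
  * (qp b q k * qp c q k * qp d q k
    / (qp (q / b) q k * qp (q / c) q k * qp (q / d) q k)))).
{ unfold Cdiv; rewrite !Cinv_mult; ring. }
rewrite hr; [ring|].
clear - habcd ha hb hc hd hq.
assert (e : d = q / (a * b * c)) by (rewrite habcd; field; auto).
rewrite e; field; auto.
Qed.

Lemma psi_reflection_q (q a s t u v b c d : C) (k : nat) :
  q <> 0 -> q ^ 3 = a * b * c * d ->
  s ^ 2 = a -> t ^ 2 = q * a -> v ^ 2 = q ^ 3 / a -> u ^ 2 = q * (q ^ 3 / a) ->
  pole_free (q ^ 3 / a) q ->
  let xs := [s; - s; t; - t; b; c; d] in
  let cs := [u; - u; v; - v; q ^ 2 / b; q ^ 2 / c; q ^ 2 / d] in
  psi_defined xs cs q ->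
  psi_term xs cs q (q ^ 2 / a) (- Z.of_nat (S k))
  = - q * (q ^ k * q ^ k) * psi_term xs cs q (q ^ 2 / a) (Z.of_nat k).
Proof.
intros hq habcd hs ht hv hu hY xs cs [hcs hxs]; subst xs cs.
destruct (factors_nz a b c d (q ^ 3) (eq_sym habcd) (Cpow_nz _ _ hq)) as [ha [hb [hc hd]]].
rewrite (psi_term_of_nat q a (q ^ 3 / a)), (psi_term_opp_of_nat q a (q ^ 3 / a)) by assumption.
assert (hna := neg_factor_nz q a s t hq hs ht
  (fun x hx => hxs x ltac:(cbn [In] in *; tauto))).
assert (hdiv : forall (x : C) n, x <> 0 -> q ^ n / x <> 0).
{ intros x n hx e; apply (Cpow_nz q n hq).
  transitivity (q ^ n / x * x); [field; exact hx|rewrite e; ring]. }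
(* The product of the paired parameters is q^2, so one factor stays unreflected: (1 - q/x) / (1 -
   x/q) = - q/x. Its three occurrences, for b, c and d, produce the minus sign. *)
assert (ratio : forall x : C, x <> 0 -> (forall i, 1 - x / q ^ S i <> 0) ->
  pole_free (q ^ 2 / x) q ->
  neg_qp (q ^ 2 / x) q (S k) / neg_qp x q (S k)
  = - (q / x) * (q ^ 2 / x / x) ^ k * (qp x q k / qp (q ^ 2 / x) q k)).
{ intros x hx hnx hpx; pose proof (neg_qp_ratio x (q ^ 2 / x) q 1 k hq hx) as h.
  cbn [Nat.add] in h; rewrite h; auto; [|field; exact hx].
  do 2 f_equal; specialize (hnx 0%nat); unfold neg_qp; cbn [Cprod].
  rewrite Cpow_1_r in *; cbn [Cpow]; field; repeat split; auto.
  intros e; apply hnx; transitivity ((q - x) / q); [field; exact hq|].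
  rewrite e; field; exact hq. }
(* Here the product of the paired parameters is q^3. Two factors stay unreflected, and their signs
   cancel in (q/a)(q^2/a). *)
assert (ratio_a : neg_qp (q ^ 3 / a) q (2 * S k) / neg_qp a q (2 * S k)
  = q ^ 3 / a / a * (q ^ 3 / a / a) ^ (2 * k)
    * (qp a q (2 * k) / qp (q ^ 3 / a) q (2 * k))).
{ pose proof (neg_qp_ratio a (q ^ 3 / a) q 2 (2 * k) hq ha) as h.
  replace (2 * S k)%nat with (2 + 2 * k)%nat by lia; rewrite h; auto; [|field; exact ha].
  do 2 f_equal; unfold neg_qp; cbn [Cprod].
  assert (h0 := hna 0%nat); assert (h1 := hna 1%nat); cbn [Cpow] in *.
  rewrite !Cmult_1_r in *; field; repeat split; auto.
  - intros e; apply h1; transitivity ((q * q - a) / (q * q)); [field; exact hq|].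
    rewrite e; field; exact hq.
  - intros e; apply h0; transitivity ((q - a) / q); [field; exact hq|].
    rewrite e; field; exact hq. }
assert (Hb : pole_free (q ^ 2 / b) q) by (exact (hcs (q ^ 2 / b) ltac:(cbn [In]; tauto))).
assert (Hc : pole_free (q ^ 2 / c) q) by (exact (hcs (q ^ 2 / c) ltac:(cbn [In]; tauto))).
assert (Hd : pole_free (q ^ 2 / d) q) by (exact (hcs (q ^ 2 / d) ltac:(cbn [In]; tauto))).
assert (hnb := hxs b ltac:(cbn [In]; tauto)); assert (hnc := hxs c ltac:(cbn [In]; tauto)).
assert (hnd := hxs d ltac:(cbn [In]; tauto)).
rewrite ratio_a.
set (A := q ^ 3 / a / a); set (z := q ^ 2 / a).
transitivity (A * A ^ (2 * k) * (qp a q (2 * k) / qp (q ^ 3 / a) q (2 * k))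
  * (neg_qp (q ^ 2 / b) q (S k) / neg_qp b q (S k)
    * (neg_qp (q ^ 2 / c) q (S k) / neg_qp c q (S k))
    * (neg_qp (q ^ 2 / d) q (S k) / neg_qp d q (S k))) / z ^ S k).
{ unfold Cdiv; rewrite !Cinv_mult; ring. }
rewrite !ratio by assumption.
assert (hz : z <> 0) by (apply hdiv, ha).
pose proof (pow_regroup A (q ^ 2 / b / b) (q ^ 2 / c / c) (q ^ 2 / d / d) z (q * q) k hz) as hr.
assert (ed : d = q ^ 3 / (a * b * c)) by (rewrite habcd; field; auto).
transitivity (- (A * (q / b) * (q / c) * (q / d) / z)
  * (A ^ (2 * k) * (q ^ 2 / b / b) ^ k * (q ^ 2 / c / c) ^ k * (q ^ 2 / d / d) ^ k / z ^ k)
  * (qp a q (2 * k) / qp (q ^ 3 / a) q (2 * k)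
  * (qp b q k * qp c q k * qp d q k
    / (qp (q ^ 2 / b) q k * qp (q ^ 2 / c) q k * qp (q ^ 2 / d) q k)))).
{ rewrite (Cpow_S z); unfold Cdiv; rewrite !Cinv_mult; ring. }
rewrite hr, Cpow_mult_l.
- replace (A * (q / b) * (q / c) * (q / d) / z) with q; [ring|].
  clear - ed ha hb hc hq; unfold A, z; rewrite ed; field; auto.
- clear - ed ha hb hc hq; unfold A, z; rewrite ed; field; auto.
Qed.

Lemma phi_term_phi_coef (p q a b c d z : C) (n : nat) :
  phi_term [a; a * b / p; a * c / p; a * d / p] [p * q / b; p * q / c; p * q / d] q z n
  = phi_coef p q a b c d n * z ^ n.
Proof.
unfold phi_term, phi_coef, qpochs, Cprod_list; cbn [map fold_right].
rewrite !qpoch_of_nat, !Cmult_1_r; unfold Cdiv; rewrite !Cinv_mult; ring.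
Qed.

Lemma is_series_minus_C (f g : nat -> C) (l m : C) :
  is_series f l -> is_series g m -> is_series (fun n => f n - g n) (l - m).
Proof. exact (is_series_minus f g l m). Qed.

Lemma is_series_scal_C (k : C) (f : nat -> C) (l : C) :
  is_series f l -> is_series (fun n => k * f n) (k * l).
Proof. exact (is_series_scal k f l). Qed.

Lemma is_series_ext_C (f g : nat -> C) (l m : C) :
  (forall n, f n = g n) -> l = m -> is_series f l -> is_series g m.
Proof. intros h <-; exact (is_series_ext f g l h). Qed.

Lemma is_series_tail (f : nat -> C) (l : C) :
  f 0%nat = 0 -> is_series f l -> is_series (fun n => f (S n)) l.
Proof.
intros h0 h; apply (@is_series_incr_1 C_AbsRing C_NormedModule).
rewrite h0; revert h; apply is_series_ext_C; [reflexivity|].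
symmetry; exact (Cplus_0_r l).
Qed.

Close Scope C_scope.

(** * Unfolding the one-sided identity in the two cases *)

Theorem theorem9 :
  forall q a b c d : C,
  0 < Cmod q < 1 ->
  (* (i); [sa], [sqa], [sqda] are square roots of a, qa, q/a *)
  (q = (a * b * c * d)%C ->
   Rmax (Cmod (q / a)%C) (Cmod (q / (a ^ 2))%C) < 1 ->
   forall sa sqa sqda : C,
   (sa ^ 2)%C = a -> (sqa ^ 2)%C = (q * a)%C -> (sqda ^ 2)%C = (q / a)%C ->
   let xs := [sa; (- sa)%C; sqa; (- sqa)%C; b; c; d] in
   let cs := [(q / sa)%C; (- (q / sa))%C; sqda; (- sqda)%C;
              (q / b)%C; (q / c)%C; (q / d)%C] in
   psi_defined xs cs q ->
   exists S : C,
     is_phi [a; (a * b)%C; (a * c)%C; (a * d)%C]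
            [(q / b)%C; (q / c)%C; (q / d)%C] q (q / (a ^ 2))%C S /\
     is_psi xs cs q (q / a)%C
       (qpochs_inf [q; (q / (a ^ 2))%C] q
          / qpochs_inf [(q / a)%C; (q / a)%C] q * S)%C)
  /\
  (* (ii); [sa], [sqa], [sq3a] are square roots of a, qa, q^3/a *)
  ((q ^ 3)%C = (a * b * c * d)%C ->
   Rmax (Cmod (q ^ 2 / a)%C) (Cmod (q ^ 3 / (a ^ 2))%C) < 1 ->
   forall sa sqa sq3a : C,
   (sa ^ 2)%C = a -> (sqa ^ 2)%C = (q * a)%C -> (sq3a ^ 2)%C = (q ^ 3 / a)%C ->
   let xs := [sa; (- sa)%C; sqa; (- sqa)%C; b; c; d] in
   let cs := [(q ^ 2 / sa)%C; (- (q ^ 2 / sa))%C; sq3a; (- sq3a)%C;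
              (q ^ 2 / b)%C; (q ^ 2 / c)%C; (q ^ 2 / d)%C] in
   psi_defined xs cs q ->
   exists S : C,
     is_phi [a; (a * b / q)%C; (a * c / q)%C; (a * d / q)%C]
            [(q ^ 2 / b)%C; (q ^ 2 / c)%C; (q ^ 2 / d)%C]
            q (q ^ 3 / (a ^ 2))%C S /\
     is_psi xs cs q (q ^ 2 / a)%C
       (qpochs_inf [q; (q ^ 3 / (a ^ 2))%C] q
          / qpochs_inf [(q ^ 2 / a)%C; (q ^ 3 / a)%C] q * S)%C).
Proof.
intros q a b c d hq; assert (hq0 : q <> 0%C) by (apply Cmod_gt_0, hq).
split; intros habcd hmax s t v hs ht hv xs cs hdef.
- destruct (factors_nz a b c d q (eq_sym habcd) hq0) as [ha [hb [hc hd]]].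
  assert (hu : ((q / s) ^ 2 = q * (q / a))%C).
  { assert (hs0 : s <> 0%C) by (intros ->; apply ha; rewrite <- hs; ring).
    rewrite <- hs; field; auto. }
  assert (hv2 : (v ^ 2 = 1 ^ 2 * q / a)%C) by (rewrite hv; field; auto).
  assert (e1 : forall x, (1 * q / x = q / x)%C) by (intros; now rewrite Cmult_1_l).
  assert (ez : (1 ^ 2 * q / a ^ 2 = q / a ^ 2)%C) by (field; auto).
  assert (eY : (1 ^ 2 * q / a = q / a)%C) by (field; auto).
  assert (ed : forall x y, (x * y / 1 = x * y)%C) by (intros; field; exact C1_nz).
  assert (hqa : Cmod (q / a) < 1) by (eapply Rle_lt_trans; [apply Rmax_l|exact hmax]).
  assert (hz : Cmod (q / a ^ 2) < 1) by (eapply Rle_lt_trans; [apply Rmax_r|exact hmax]).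
  assert (Hb : pole_free (q / b) q) by (exact (proj1 hdef (q / b)%C ltac:(cbn [In cs]; tauto))).
  assert (Hc : pole_free (q / c) q) by (exact (proj1 hdef (q / c)%C ltac:(cbn [In cs]; tauto))).
  assert (Hd : pole_free (q / d) q) by (exact (proj1 hdef (q / d)%C ltac:(cbn [In cs]; tauto))).
  destruct (folded_transformation 1 q a b c d) as [S [hS1 hS2]];
    rewrite ?e1, ?ez, ?Cmod_1; auto; [exact C1_nz|lra|rewrite <- habcd; ring|].
  destruct (folded_term_series 1 q a b c d) as [l hl];
    rewrite ?e1, ?Cmod_1; auto; [lra|].
  assert (hf : forall k, psi_term xs cs q (q / a) (Z.of_nat k) = folded_term 1 q a b c d k).
  { intros k; unfold xs, cs; rewrite (psi_term_of_nat q a (q / a)) by assumption.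
    unfold folded_term, well_poised3; now rewrite !e1, eY. }
  exists S; split.
  + revert hS1; apply is_series_ext_C; [|reflexivity]; intros n.
    rewrite <- phi_term_phi_coef, !e1, !ed, ez; reflexivity.
  + exists l; eexists; split; [|split].
    * revert hl; apply is_series_ext_C; [|reflexivity]; intros n; now rewrite hf.
    (* The negative half is the folded series minus the nonnegative half. Its term at k = 0
       vanishes, and dropping it shifts the index to that of -(n+1). *)
    * pose proof (is_series_minus_C _ _ _ _ hS2 hl) as h.
      apply is_series_tail in h; [|cbn [very_well]; ring].
      revert h; apply is_series_ext_C; [|reflexivity]; intros n.
      unfold xs, cs; rewrite psi_reflection_1; auto.
      -- fold xs cs; rewrite hf, very_well_1 by assumption; ring.
      -- apply pole_free_small; lra.
    * unfold qpochs_inf, Cprod_list; cbn [map fold_right].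
      rewrite e1, ez, eY, !Cmult_1_l, !Cmult_1_r; ring.
- assert (hq3 : (q ^ 3 <> 0)%C) by (apply Cpow_nz, hq0).
  destruct (factors_nz a b c d (q ^ 3) (eq_sym habcd) hq3) as [ha [hb [hc hd]]].
  assert (hu : ((q ^ 2 / s) ^ 2 = q * (q ^ 3 / a))%C).
  { assert (hs0 : s <> 0%C) by (intros ->; apply ha; rewrite <- hs; ring).
    rewrite <- hs; field; auto. }
  assert (e1 : (q * q = q ^ 2)%C) by ring.
  assert (e2 : (q ^ 2 * q = q ^ 3)%C) by ring.
  assert (hqa : Cmod (q ^ 2 / a) < 1) by (eapply Rle_lt_trans; [apply Rmax_l|exact hmax]).
  assert (hz : Cmod (q ^ 3 / a ^ 2) < 1) by (eapply Rle_lt_trans; [apply Rmax_r|exact hmax]).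
  assert (Hb : pole_free (q ^ 2 / b) q)
    by (exact (proj1 hdef (q ^ 2 / b)%C ltac:(cbn [In cs]; tauto))).
  assert (Hc : pole_free (q ^ 2 / c) q)
    by (exact (proj1 hdef (q ^ 2 / c)%C ltac:(cbn [In cs]; tauto))).
  assert (Hd : pole_free (q ^ 2 / d) q)
    by (exact (proj1 hdef (q ^ 2 / d)%C ltac:(cbn [In cs]; tauto))).
  destruct (folded_transformation q q a b c d) as [S [hS1 hS2]];
    rewrite ?e1, ?e2; auto; [lra|].
  destruct (folded_term_series q q a b c d) as [l hl];
    rewrite ?e1; auto; [lra|].
  assert (hf : forall k, psi_term xs cs q (q ^ 2 / a) (Z.of_nat k) = folded_term q q a b c d k).
  { intros k; unfold xs, cs; rewrite (psi_term_of_nat q a (q ^ 3 / a)) by assumption.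
    unfold folded_term, well_poised3; now rewrite !e1, e2. }
  exists S; split.
  + revert hS1; apply is_series_ext_C; [|reflexivity]; intros n.
    rewrite <- phi_term_phi_coef, !e1, e2; reflexivity.
  + exists l; eexists; split; [|split].
    * revert hl; apply is_series_ext_C; [|reflexivity]; intros n; now rewrite hf.
    (* Now k is paired with -1-k, so there is no unpaired term and no shift. The factor 1 - q is the
       one in [very_well_q]. *)
    * pose proof (is_series_minus_C _ _ _ _ (is_series_scal_C (1 - q)%C _ _ hS2) hl) as h.
      revert h; apply is_series_ext_C; [|reflexivity]; intros n.
      unfold xs, cs; rewrite psi_reflection_q; auto.
      -- fold xs cs; rewrite hf, Cmult_assoc, very_well_q by assumption; ring.
      -- apply pole_free_small; [lra|].
         replace (q ^ 3 / a)%C with (q * (q ^ 2 / a))%C by (field; auto).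
         rewrite Cmod_mult; pose proof (Cmod_ge_0 (q ^ 2 / a)); nra.
    * unfold qpochs_inf, Cprod_list; cbn [map fold_right].
      (* The factor 1 - q from folding completes (q^2;q)_inf to the (q;q)_inf of the statement. *)
      rewrite (qpoch_inf_split q q 1) by lra.
      rewrite Cpow_1_r, e1, e2, !Cmult_1_r.
      change (qp q q 1) with (1 * (1 - q * 1))%C; unfold Cdiv; ring.
Qed.
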